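(* Let $\mathcal{A}=V(\ell_0\cdots\ell_n)\subseteq\mathbb{C}^d$ be an arrangement of $n+1\ge d+2$ hyperplanes given by a matrix $L=[\,b\mid A\,]^{T}\in\mathbb{C}^{(d+1)\times(n+1)}$, where $(\ell_0(x),\dots,\ell_n(x))^T=Ax+b$, and let $X=\mathbb{C}^d\setminus\mathcal{A}$. Assume that $L$ has a $(d+1)\times(d+2)$ submatrix which is uniform and for which also the corresponding $d\times(d+2)$ submatrix of $A^{T}$ (given by the same columns) is uniform. Then $\mathrm{Ram}(\mathcal{L}_X^\circ\to\mathbb{P}^n)$ and $\nabla_{\log}(X)$ are reduced and irreducible.
   Context: Here $d\ge1$. A matrix is uniform if all its maximal minors are non-zero. Let $\mathcal{L}_u(x)=\sum_{i=0}^nu_i\log\ell_i(x)$ and let $\mathcal{L}_X^\circ=\{(u,x)\in\mathbb{P}^n\times X:\nabla_x\mathcal{L}_u(x)=0\}$, i.e. the locus $A^{T}\operatorname{diag}(1/\ell_0(x),\dots,1/\ell_n(x))\,u=0$, a smooth irreducible variety of dimension $n$, with first projection $f\colon\mathcal{L}_X^\circ\to\mathbb{P}^n$. The ramification locus $\mathrm{Ram}(f)=\mathrm{Ram}(\mathcal{L}_X^\circ\to\mathbb{P}^n)$ is the subscheme of $\mathcal{L}_X^\circ$ locally defined by the Jacobian determinant of $f$; equivalently, by the Hessian determinant $\det\big(A^{T}\operatorname{diag}(u_0/\ell_0^2,\dots,u_n/\ell_n^2)A\big)=0$. The logarithmic discriminant $\nabla_{\log}(X)$ is the branch locus of $f$,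 i.e. the closure of the scheme-theoretic image $f(\mathrm{Ram}(f))\subseteq\mathbb{P}^n$; its underlying set is the closure of the set of $u\in\mathbb{P}^n$ for which the critical scheme of $\mathcal{L}_u$ on $X$ is infinite or non-reduced. *)

(* Defs.v *)
From mathcomp Require Export all_boot all_order all_algebra.
From mathcomp Require Export reals complex mpoly.

Set Implicit Arguments.
Unset Strict Implicit.
Unset Printing Implicit Defensive.

Import GRing.Theory.
Local Open Scope ring_scope.

Section Ideals.
Variable T : comNzRingType.

Definition ideal (I : T -> Prop) : Prop :=
  [/\ I 0, forall a b, I a -> I b -> I (a + b) & forall c a, I a -> I (c * a)].

Definition prime_ideal (P : T -> Prop) : Prop :=
  [/\ ideal P, ~ P 1 & forall a b, P (a * b) -> P a \/ P b].

Definition radical_ideal (I : T -> Prop) : Prop :=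
  forall (f : T) (k : nat), I (f ^+ k) -> I f.

Definition ideal_gen (G : T -> Prop) : T -> Prop :=
  fun a => forall I, ideal I -> (forall g, G g -> I g) -> I a.

End Ideals.

(* Closed subschemes of P^n_B = Proj B[u_0, .., u_n].  A homogeneous ideal I  *)
(* of B[u] (graded by the degree in u) stands for the closed subscheme        *)
(* V_+(I) = Proj (B[u] / I); different ideals may define the same subscheme,  *)
(* but every notion below depends on V_+(I) only.                             *)
Section ClosedSubschemes.
Variables (B : comNzRingType) (n : nat).
Local Notation S := {mpoly B[n.+1]}.
Implicit Types (I P J K : S -> Prop).

Definition is_homog (p : S) : Prop := exists k : nat, p \is k.-homog.

Definition homog_ideal I : Prop :=
  ideal I /\ forall (p : S) (k : nat), I p -> I (pihomog mdeg k p).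

Definition proj_point P : Prop :=
  [/\ prime_ideal P, homog_ideal P & exists i : 'I_n.+1, ~ P 'X_i].

Definition point_of I P : Prop := proj_point P /\ forall f, I f -> P f.

(* The Zariski closed subsets of Proj B[u] are the V_+(J), J a homogeneous    *)
(* ideal.  The empty scheme is not irreducible.                               *)
Definition irreducible_scheme I : Prop :=
  (exists P, point_of I P) /\
  forall J K, homog_ideal J -> homog_ideal K ->
    (forall P, point_of I P ->
       (forall f, J f -> P f) \/ (forall f, K f -> P f)) ->
    (forall P, point_of I P -> forall f, J f -> P f) \/
    (forall P, point_of I P -> forall f, K f -> P f).

(* The chart V_+(I) \cap D_+(u_i) is Spec (B[u] / (I, u_i - 1)), the          *)
(* coordinate u_j standing for the function u_j / u_i.                        *)
Definition chart_ideal I (i : 'I_n.+1) : S -> Prop :=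
  ideal_gen (fun f => I f \/ f = 'X_i - 1).

Definition reduced_scheme I : Prop :=
  forall i : 'I_n.+1, radical_ideal (chart_ideal I i).

End ClosedSubschemes.

(* Scheme-theoretic image of V_+(I) under P^n_B -> P^n_k, for a k-algebra B.  *)
(* Its ideal sheaf is the kernel of O_{P^n_k} -> pr_* O_{V_+(I)}; a form g of *)
(* degree e is a section of the twist by e of this kernel iff, for every i,   *)
(* g / u_i^e vanishes on the chart D_+(u_i) of V_+(I).                        *)
Definition scheme_image (k B : comNzRingType) (n : nat)
    (iota : {rmorphism k -> B}) (I : {mpoly B[n.+1]} -> Prop) :
    {mpoly k[n.+1]} -> Prop :=
  ideal_gen (fun g => is_homog g /\
                      forall i, chart_ideal I i (map_mpoly iota g)).

(* Rows and columns are selected by injections: reordering a selection only   *)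
(* changes the sign of the minor.                                             *)
Definition uniform (F : fieldType) (p q : nat) (M : 'M[F]_(p, q)) : Prop :=
  forall (f : 'I_(minn p q) -> 'I_p) (g : 'I_(minn p q) -> 'I_q),
    injective f -> injective g -> \det (mxsub f g M) != 0.

Section Arrangement.
Variables (F : fieldType) (n d : nat).
Variables (A : 'M[F]_(n.+1, d)) (b : 'cV[F]_n.+1).

(* X = Spec F[x_1, .., x_d, t] / (t l_0 ... l_n - 1): t is the inverse of     *)
(* l_0 ... l_n.                                                               *)
Local Notation Q := {mpoly F[d.+1]}.
Local Notation S := {mpoly Q[n.+1]}.

Definition xvar (j : 'I_d) : Q := 'X_(lift ord_max j).
Definition tvar : Q := 'X_ord_max.

Definition ell (i : 'I_n.+1) : Q :=
  \sum_(j < d) (A i j)%:MP * xvar j + (b i 0)%:MP.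

Definition X_eqn : Q := tvar * (\prod_i ell i) - 1.

(* 1 / l_i in O(X) *)
Definition inv_ell (i : 'I_n.+1) : Q := tvar * \prod_(j | j != i) ell j.

Definition A_poly : 'M[S]_(n.+1, d) := map_mx (fun a : F => a%:MP%:MP) A.

(* nabla_x L_u = A^T diag(1 / l) u *)
Definition log_gradient : 'cV[S]_d :=
  A_poly^T *m diag_mx (\row_i (inv_ell i)%:MP) *m \col_i 'X_i.

(* A^T diag(u / l^2) A, the Hessian matrix of L_u up to sign *)
Definition log_hessian : 'M[S]_d :=
  A_poly^T *m diag_mx (\row_i ((inv_ell i ^+ 2)%:MP * 'X_i)) *m A_poly.

(* X is closed in the affine space with coordinates (x, t), so a closed       *)
(* subscheme of P^n x X is one of P^n_Q containing X_eqn in its ideal.  The   *)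
(* equations log_gradient = 0 cut out L_X^o in P^n x X; the Jacobian          *)
(* determinant of L_X^o -> P^n is, up to a local unit, \det log_hessian.      *)
Definition Ram : S -> Prop :=
  ideal_gen (fun g => [\/ g = X_eqn%:MP,
                          exists k, g = log_gradient k 0 |
                          g = \det log_hessian]).

Definition log_discriminant : {mpoly F[n.+1]} -> Prop :=
  scheme_image (@mpolyC d.+1 F) Ram.

End Arrangement.

(* Main.v *)
Require Import Defs.
From mathcomp Require Import perm ring.
From mathcomp Require boolp.

Set Implicit Arguments.
Unset Strict Implicit.
Unset Printing Implicit Defensive.

Import GRing.Theory.
Local Open Scope ring_scope.

(** The proof rests on one change of variables. With w_i = u_i / l_i, the
    equations of the critical locus become A^T w = 0, so L_X^o is the product
    of X with the projective space of ker A^T, and Ram is the hypersurface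
    det (A^T diag (w / l) A) = 0 of this product. Everything follows once the
    ideal Ram A b is known to be prime: a homogeneous prime ideal that omits
    some u_i is the generic point of the scheme it defines, hence this scheme
    is reduced and irreducible ([reduced_proj_point],
    [irreducible_proj_point]), and its scheme-theoretic image is given by the
    contraction of the ideal, again a prime of the same kind
    ([proj_point_scheme_image]).

    That the Hessian determinant is prime is proved without any theory of
    unique factorization. Let c be the linear relation between the d + 2
    distinguished affine forms, and e a vector of ker A^T, supported on the
    same indices, with b^T e = 1. Points of ker A^T are written w = y c + P v,
    where P is a projector onto ker A^T and v is arbitrary; this is redundant
    but has the retraction v = w, y = 0. As a polynomial in y the Hessian H
    has degree d, and its leading coefficient divides a power of lam, the
    product of all l_i. So division by H is possible after lam is inverted,
    and primality of H, up to powers of lam ([quasi_prime]), lifts from the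
    specialization v = e: the remainders of two factors whose product is
    divisible by H are compared through their leading terms along the
    specialization ([quasi_prime_specialize], [hessian_form_quasi_prime]).

    At v = e the vector w = y c + e lives on the distinguished d + 2
    hyperplanes. A Gram determinant computation ([gram_identity]) shows that H
    is there, up to factors dividing powers of lam, the form
    G = sum_i c_i^2 l_i prod_(r != i) w_r. It has degree one in x, and
    uniformity implies that its coefficients, which are polynomials in y, have
    no common zero ([pencil_form_no_root]). Solving G = 0 for one coordinate
    of x then exhibits the ideal of G as the kernel of a morphism to a field
    ([linear_form_prime]).

    Finally the substitution u_i = l_i w_i, t = 1 / lam and its retraction
    identify Ram A b with the set of all f whose pullback is divisible by H up
    to a power of lam ([Ram_param]). *)

(** * Ideals, congruences and clearing of denominators *)

Section IdealTheory.
Variables (T : comNzRingType) (I : T -> Prop).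
Hypothesis idI : ideal I.

Lemma ideal0 : I 0. Proof. by case: idI. Qed.

Lemma idealD a b : I a -> I b -> I (a + b). Proof. by case: idI => _ + _; apply. Qed.

Lemma idealMl c a : I a -> I (c * a). Proof. by case: idI => _ _; apply. Qed.

Lemma idealMr c a : I a -> I (a * c).
Proof. by rewrite mulrC; apply: idealMl. Qed.

Lemma idealB a b : I a -> I b -> I (a - b).
Proof. by move=> Ia Ib; rewrite -mulN1r; apply: idealD => //; apply: idealMl. Qed.

Lemma ideal_sum (J : Type) (r : seq J) (Q : pred J) (f : J -> T) :
  (forall j, Q j -> I (f j)) -> I (\sum_(j <- r | Q j) f j).
Proof. by move=> If; elim/big_ind: _ => //; [apply: ideal0 | apply: idealD]. Qed.

Lemma ideal_congr a b : I (a - b) -> I b -> I a.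
Proof. by move=> Iab Ib; rewrite -[a](subrK b); apply: idealD. Qed.

Lemma ideal_congr_sym a b : I (a - b) -> I (b - a).
Proof. by move=> Iab; rewrite -opprB -mulN1r; apply: idealMl. Qed.

Lemma ideal_congr_trans b a c : I (a - b) -> I (b - c) -> I (a - c).
Proof. by move=> Iab Ibc; rewrite -[a](subrK b) -addrA; apply: idealD. Qed.

Lemma ideal_congr_refl a : I (a - a).
Proof. by rewrite subrr; apply: ideal0. Qed.

Lemma ideal_congrD a b c d : I (a - b) -> I (c - d) -> I (a + c - (b + d)).
Proof. by move=> Iab Icd; rewrite opprD addrACA; apply: idealD. Qed.

Lemma ideal_congrM a b c d : I (a - b) -> I (c - d) -> I (a * c - b * d).
Proof.
move=> Iab Icd; rewrite -[a * c](subrK (b * c)) -addrA -mulrBl -mulrBr.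
by apply: idealD; [apply: idealMr | apply: idealMl].
Qed.

Lemma ideal_congr_sumr (J : Type) (r : seq J) (Q : pred J) (f g : J -> T) :
  (forall j, I (f j - g j)) ->
  I (\sum_(j <- r | Q j) f j - \sum_(j <- r | Q j) g j).
Proof.
by move=> Ifg; rewrite -sumrB; apply: ideal_sum.
Qed.

Lemma ideal_congr_det (n : nat) (M N : 'M[T]_n) :
  (forall i j, I (M i j - N i j)) -> I (\det M - \det N).
Proof.
move=> IMN; apply: ideal_congr_sumr => s.
apply: ideal_congrM; first exact: ideal_congr_refl.
apply: (big_ind2 (fun a b => I (a - b))) => [|a b c d|i _].
- exact: ideal_congr_refl.
- exact: ideal_congrM.
- exact: IMN.
Qed.

(** Powers of an element that is invertible modulo I can be cancelled. *)
Lemma ideal_unit_cancel a b c k : I (a * b - 1) -> I (a ^+ k * c) -> I c.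
Proof.
move=> Iab; elim: k c => [|k IHk] c; first by rewrite expr0 mul1r.
rewrite exprS -mulrA => Iac; apply: IHk.
rewrite -[X in I X]mul1r -(subrK (a * b) 1) mulrDl.
apply: idealD; first by apply: idealMr; apply: ideal_congr_sym.
by rewrite [a * b]mulrC -mulrA; apply: idealMl.
Qed.

End IdealTheory.

Section IdealGen.
Variable T : comNzRingType.

Lemma ideal_gen_ideal (G : T -> Prop) : ideal (ideal_gen G).
Proof.
split.
- by move=> I idI _; apply: ideal0.
- by move=> a b Ga Gb I idI GI; apply: idealD => //; [apply: Ga | apply: Gb].
- by move=> c a Ga I idI GI; apply: idealMl => //; apply: Ga.
Qed.

Lemma mem_ideal_gen (G : T -> Prop) g : G g -> ideal_gen G g.
Proof. by move=> Gg I _; apply. Qed.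

Definition divides (g a : T) := exists q, a = g * q.

Lemma ideal_principal (g : T) : ideal (divides g).
Proof.
split; first by exists 0; rewrite mulr0.
- by move=> a b [q ->] [r ->]; exists (q + r); rewrite mulrDr.
- by move=> c a [q ->]; exists (c * q); rewrite mulrCA.
Qed.

End IdealGen.

(** Identities between ring morphisms, and closure properties of subrings, need
    only be checked on constants and variables. *)
Lemma mpoly_ring_ind (R : comNzRingType) (n : nat) (P : {mpoly R[n]} -> Prop) :
  (forall c, P c%:MP) -> (forall i, P 'X_i) ->
  (forall p q, P p -> P q -> P (p + q)) ->
  (forall p q, P p -> P q -> P (p * q)) -> forall p, P p.
Proof.
move=> PC PX PD PM; elim/mpolyind => [|c m p _ _ Pp]; first exact: (PC 0).
apply: (PD) => //; rewrite -mul_mpolyC; apply: (PM) => //.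
rewrite mpolyXE_id; apply: big_ind => [||i _]; [exact: (PC 1) | exact: PM |].
elim: (m i) => [|k IHk]; first exact: (PC 1).
by rewrite exprS; apply: PM.
Qed.

Lemma poly_ring_ind (R : nzRingType) (P : {poly R} -> Prop) :
  (forall c, P c%:P) -> P 'X ->
  (forall p q, P p -> P q -> P (p + q)) ->
  (forall p q, P p -> P q -> P (p * q)) -> forall p, P p.
Proof.
move=> PC PX PD PM; elim/poly_ind => [|p c Pp]; first exact: (PC 0).
by apply: PD => //; apply: PM.
Qed.

Section Clearing.
Variables (S : comNzRingType) (C E : idomainType).
Variables (inC : {rmorphism C -> E}) (phi : {rmorphism S -> E}).
Variables (chi : {rmorphism C -> S}) (I : S -> Prop) (lam : C).
Hypothesis idI : ideal I.

(** The ring C is a model of S away from lam: [phi] sends S to fractions of C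
    with denominator a power of lam, and [chi] brings the numerators back to
    S, modulo I. Being a subring of S, the set of the f for which this works
    is everything as soon as it contains generators. *)
Definition clears (f : S) :=
  exists N c, inC (lam ^+ N) * phi f = inC c /\ I (chi lam ^+ N * f - chi c).

Lemma clearsD f g : clears f -> clears g -> clears (f + g).
Proof.
move=> [N [a [Ea Ia]]] [M [b [Eb Ib]]].
exists (N + M)%N, (lam ^+ M * a + lam ^+ N * b); split.
  by rewrite exprD !rmorphD !rmorphM -Ea -Eb /= mulrDr mulrCA -!mulrA [X in _ + X]mulrCA mulrCA.
rewrite rmorphD !rmorphM !rmorphXn /= exprD mulrDr.
apply: ideal_congrD => //.
  by rewrite [X in X * f]mulrC -mulrA -mulrBr; apply: idealMl.
by rewrite -mulrA -mulrBr; apply: idealMl.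
Qed.

Lemma clearsM f g : clears f -> clears g -> clears (f * g).
Proof.
move=> [N [a [Ea Ia]]] [M [b [Eb Ib]]].
exists (N + M)%N, (a * b); split.
  by rewrite exprD !rmorphM -Ea -Eb /= mulrACA.
by rewrite rmorphM /= exprD mulrACA; apply: ideal_congrM.
Qed.

Lemma clears_cst f c : phi f = inC c -> I (f - chi c) -> clears f.
Proof. by move=> Ef If; exists 0, c; rewrite !expr0 rmorph1 !mul1r. Qed.

End Clearing.

(** * Homogeneous primes define reduced and irreducible schemes *)

Section HomogeneousIdeals.
Variables (B : comNzRingType) (n : nat).
Local Notation S := {mpoly B[n.+1]}.

(** The elements all of whose homogeneous components lie in the ideal form an
    ideal, which contains the generators. *)
Lemma homog_ideal_gen (G : S -> Prop) :
  (forall g, G g -> is_homog g) -> homog_ideal (ideal_gen G).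
Proof.
move=> homG; split; first exact: ideal_gen_ideal.
have idI := ideal_gen_ideal G; move=> p k.
move/(_ (fun f => forall k, ideal_gen G (pihomog mdeg k f))) => Jp.
apply: Jp => [|g Gg e]; last first.
  have [d homg] := homG g Gg.
  have [<-|ned] := eqVneq d e; first by rewrite pihomog_dE //; apply: mem_ideal_gen.
  by rewrite (pihomog_ne0 ned homg); exact: (ideal0 idI).
split=> [e|a b Ja Jb e|c a Ja e].
- by rewrite pihomog0; exact: (ideal0 idI).
- by rewrite pihomogD; apply: (idealD idI).
rewrite [c](pihomog_partitionE (mf := mdeg) (leqnn _)).
rewrite [a](pihomog_partitionE (mf := mdeg) (leqnn _)).
rewrite mulr_suml raddf_sum; apply: (ideal_sum idI) => // i _.
rewrite mulr_sumr raddf_sum; apply: (ideal_sum idI) => // j _ /=.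
have hom : pihomog mdeg i c * pihomog mdeg j a \is (i + j).-homog.
  by apply: dhomogM; apply: pihomogP.
have [<-|ned] := eqVneq (i + j)%N e.
  by rewrite pihomog_dE //; apply: (idealMl idI).
by rewrite (pihomog_ne0 ned hom); exact: (ideal0 idI).
Qed.

Lemma homog_ideal_decomp (I J : S -> Prop) f :
  homog_ideal I -> ideal J -> (forall g, is_homog g -> I g -> J g) -> I f -> J f.
Proof.
move=> [_ homI] idJ IJ If; rewrite [f](pihomog_partitionE (mf := mdeg) (leqnn _)).
apply: ideal_sum => // d _; apply: IJ; last exact: homI.
by exists d; apply: pihomogP.
Qed.

(** P itself is a point of the scheme, and lies in every closed subset that
    contains all the points. *)
Lemma irreducible_proj_point (P : S -> Prop) : proj_point P -> irreducible_scheme P.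
Proof.
move=> ptP; have PP : point_of P P by split.
split; first by exists P.
move=> J K _ _ /(_ P PP) [JP|KP]; [left|right] => Q [_ PQ] f.
  by move/JP/PQ.
by move/KP/PQ.
Qed.

End HomogeneousIdeals.

Section Dehomogenize.
Variables (B : idomainType) (n : nat) (i : 'I_n.+1).
Local Notation S := {mpoly B[n.+1]}.
Local Notation E := {fraction S}.
Local Notation "x %:F" := (tofrac x).

Let cst : {rmorphism B -> E} := (@tofrac S) \o (@mpolyC n.+1 B).

(** The chart D_+(u_i) is studied through u_j |-> u_j / u_i, with values in the
    fraction field: it kills u_i - 1 and turns a form f of degree d into
    f / u_i^d. *)
Definition dehomog : {rmorphism S -> E} :=
  mmap cst (fun j => ('X_j : S)%:F / ('X_i : S)%:F).

Lemma dehomog_var j : dehomog 'X_j = ('X_j : S)%:F / ('X_i : S)%:F.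
Proof. by rewrite /dehomog /= mmapX mmap1U. Qed.

Lemma tofrac_inj : injective (@tofrac S).
Proof. by move=> a b /eqP; rewrite tofrac_eq => /eqP. Qed.

Lemma frac_var_neq0 : (('X_i : S)%:F : E) != 0.
Proof.
rewrite tofrac_eq0; apply/eqP => /mpolyP /(_ U_(i)%MM).
by rewrite mcoeffX eqxx mcoeff0 => /eqP; rewrite oner_eq0.
Qed.

Lemma dehomog_homog f d : f \is d.-homog ->
  (('X_i : S) ^+ d)%:F * dehomog f = f%:F.
Proof.
move=> /dhomogP homf; rewrite /dehomog /= /mmap mulr_sumr [in RHS](mpolyE f) rmorph_sum /=.
apply: eq_big_seq => m /homf <-; rewrite -mul_mpolyC rmorphM /= mulrCA; congr (_ * _).
rewrite [in RHS]mpolyXE_id rmorph_prod /mmap1 mdegE rmorphXn /= -prodrXr -big_split /=.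
apply: eq_bigr => j _; rewrite rmorphXn -exprMn; congr (_ ^+ _).
by rewrite mulrCA mulfV ?mulr1 // frac_var_neq0.
Qed.

Lemma dehomog_clears f :
  clears (@tofrac S) dehomog idfun (divides ('X_i - 1)) 'X_i f.
Proof.
have idI := ideal_principal ('X_i - 1 : S).
elim/mpoly_ring_ind: f => [c|j|f g|f g].
- apply: clears_cst; first by rewrite /dehomog /= mmapC.
  exact: ideal_congr_refl.
- exists 1, 'X_j; rewrite !expr1; split; last by exists 'X_j; rewrite mulrBl mul1r.
  by rewrite dehomog_var mulrCA mulfV ?mulr1 // frac_var_neq0.
- exact: clearsD.
- exact: clearsM.
Qed.

Variable (P : S -> Prop).
Hypothesis ptP : proj_point P.

Let pmP : prime_ideal P. Proof. by case: ptP. Qed.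
Let idP : ideal P. Proof. by case: pmP. Qed.

(** The right-hand side describes an ideal that contains u_i - 1 and, by
    homogeneity, P. *)
Lemma chart_dehomog f : chart_ideal P i f ->
  exists N c, P c /\ (('X_i : S) ^+ N)%:F * dehomog f = c%:F.
Proof.
pose K f := exists N c, P c /\ (('X_i : S) ^+ N)%:F * dehomog f = c%:F.
have idK : ideal K.
  split=> [|a b [N [c [Pc Ec]]] [M [d [Pd Ed]]]|b a [N [c [Pc Ec]]]].
  - by exists 0, 0; split; [apply: ideal0 | rewrite !rmorph0 mulr0].
  - exists (N + M)%N, ('X_i ^+ M * c + 'X_i ^+ N * d).
    split; first by apply: idealD => //; apply: idealMl.
    by rewrite exprD !rmorphD !rmorphM /= -Ec -Ed mulrDr mulrCA -!mulrA [X in _ + X]mulrCA mulrCA.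
  - have [M [d [Ed _]]] := dehomog_clears b.
    exists (M + N)%N, (d * c); split; first exact: idealMl.
    by rewrite exprD !rmorphM /= -Ec -Ed mulrACA.
move=> Jf; apply: (Jf K idK) => g [Pg|->].
  have homP : homog_ideal P by case: ptP.
  apply: (homog_ideal_decomp homP idK _ Pg) => h [d homh] Ph.
  by exists d, h; split=> //; apply: dehomog_homog.
exists 0, 0; split; first exact: ideal0.
by rewrite rmorphB (rmorph1 dehomog) dehomog_var divff ?frac_var_neq0 // subrr mulr0 rmorph0.
Qed.

Lemma chart_homog f : ~ P 'X_i -> is_homog f -> chart_ideal P i f -> P f.
Proof.
move=> PXi [d homf] /chart_dehomog [N [c [Pc Ec]]].
have primeX k g : P ('X_i ^+ k * g) -> P g.
  elim: k g => [|k IHk] g; first by rewrite expr0 mul1r.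
  by rewrite exprS -mulrA; case: pmP => _ _ pm /pm [] // /IHk.
apply: (primeX N); suff -> : 'X_i ^+ N * f = 'X_i ^+ d * c by apply: idealMl.
by apply: tofrac_inj; rewrite !rmorphM /= -Ec -(dehomog_homog homf) mulrCA.
Qed.

(** When u_i is outside P, the chart ideal consists of the f with u_i^N times
    their dehomogenization in P, a condition that passes from f^k to f because
    P is prime; when u_i is in P, the chart is empty. *)
Lemma radical_chart : radical_ideal (chart_ideal P i).
Proof.
have idJ : ideal (chart_ideal P i) := ideal_gen_ideal _.
have [PXi|PXi] := boolp.EM (P 'X_i).
  suff J1 : chart_ideal P i 1.
    by move=> f k _; rewrite -[f]mulr1; apply: (idealMl idJ).
  rewrite -[1](subKr 'X_i); apply: (idealB idJ); apply: mem_ideal_gen; first by left.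
  by right.
have J1 : chart_ideal P i ('X_i * 1 - 1) by rewrite mulr1; apply: mem_ideal_gen; right.
move=> f k /chart_dehomog [N [c [Pc Ec]]].
have [M [d [Ed [q Eq]]]] := dehomog_clears f.
have Pd : P d.
  have : P ('X_i ^+ N * d ^+ k).
    suff -> : 'X_i ^+ N * d ^+ k = ('X_i ^+ M) ^+ k * c by apply: idealMl.
    apply: tofrac_inj; rewrite !(tofracM, tofracXn) -Ec -Ed (rmorphXn dehomog).
    rewrite exprMn mulrCA; congr (_ ^+ _ * (_ * _)); [exact: tofracXn | exact: esym (tofracXn _ _)].
  have primeX j g h : ~ P h -> P (h ^+ j * g) -> P g.
    move=> nPh; elim: j g => [|j IHj] g; first by rewrite expr0 mul1r.
    by rewrite exprS -mulrA; case: pmP => _ _ pm /pm [] // /IHj.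
  move/(primeX _ _ _ PXi); have [//|nPd] := boolp.EM (P d).
  by rewrite -[d ^+ k]mulr1 => /(primeX _ _ _ nPd); case: pmP.
have Jd : chart_ideal P i d by apply: mem_ideal_gen; left.
apply: (ideal_unit_cancel idJ (k := M) J1); apply: (ideal_congr idJ _ Jd).
rewrite Eq; apply: (idealMr idJ); apply: mem_ideal_gen; right=> //.
Qed.

End Dehomogenize.

Lemma reduced_proj_point (B : idomainType) (n : nat) (P : {mpoly B[n.+1]} -> Prop) :
  proj_point P -> reduced_scheme P.
Proof. by move=> ptP i; apply: radical_chart. Qed.

Section SchemeImage.
Variables (k B : idomainType) (n : nat) (iota : {rmorphism k -> B}).
Variable P : {mpoly B[n.+1]} -> Prop.
Hypothesis ptP : proj_point P.

Let pmP : prime_ideal P. Proof. by case: ptP. Qed.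
Let idP : ideal P. Proof. by case: pmP. Qed.
Let homP : homog_ideal P. Proof. by case: ptP. Qed.

Lemma map_pihomog d (g : {mpoly k[n.+1]}) :
  map_mpoly iota (pihomog mdeg d g) = pihomog mdeg d (map_mpoly iota g).
Proof.
elim/mpolyind: g => [|c m p _ _ IHp]; first by rewrite !(pihomog0, rmorph0).
rewrite !(pihomogD, rmorphD) /= -/(map_mpoly _ _) IHp; congr (_ + _).
rewrite map_mpolyZ map_mpolyX !linearZ /= !pihomogX map_mpolyZ.
by case: ifP => _; rewrite ?map_mpolyX ?rmorph0.
Qed.

(** A single nonempty chart decides whether a form lies in P, because P is
    prime. *)
Lemma scheme_image_contraction g :
  scheme_image iota P g <-> P (map_mpoly iota g).
Proof.
have idI : ideal (fun g => P (map_mpoly iota g)).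
  split=> [|a b Pa Pb|c a Pa].
  - by rewrite rmorph0; apply: ideal0.
  - by rewrite rmorphD; apply: idealD.
  - by rewrite rmorphM; apply: idealMl.
split=> [|Pg].
  have [i PXi] : exists i : 'I_n.+1, ~ P 'X_i by case: ptP.
  move=> If; apply: (If _ idI) => h [[d homh] Jh]; apply: (chart_homog ptP PXi) => //; exists d.
  by rewrite homog_piE -map_pihomog pihomog_dE.
rewrite [g](pihomog_partitionE (mf := mdeg) (leqnn _)).
apply: (ideal_sum (ideal_gen_ideal _)) => d _; apply: mem_ideal_gen; split.
  by exists d; apply: pihomogP.
move=> i; apply: mem_ideal_gen; left.
by rewrite map_pihomog; case: homP => _; apply.
Qed.

Lemma proj_point_scheme_image : proj_point (scheme_image iota P).
Proof.
have E := scheme_image_contraction.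
split.
- split; first exact: ideal_gen_ideal.
    by move=> /E; rewrite rmorph1; case: pmP.
  move=> a b /E; rewrite rmorphM; case: pmP => _ _ pm /pm [] ?; [left|right]; exact/E.
- split; first exact: ideal_gen_ideal.
  by move=> p d /E Pp; apply/E; rewrite map_pihomog; case: homP => _; apply.
- have [i PXi] : exists i : 'I_n.+1, ~ P 'X_i by case: ptP.
  by exists i => /E; rewrite /= map_mpolyX.
Qed.

End SchemeImage.

(** * Primality up to powers of an element, and specialization *)

(** This says that H generates a prime ideal, possibly the unit ideal, once lam
    is inverted; it spares the construction of the localization. *)
Definition quasi_prime (T : comNzRingType) (lam H : T) :=
  forall f g, divides H (f * g) ->
  exists M, divides H (lam ^+ M * f) \/ divides H (lam ^+ M * g).

Section Specialize.
Variables (R : idomainType) (pi : {rmorphism R -> R}) (z lam : R).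
Hypotheses (pi_z : pi z = 0) (z_neq0 : z != 0).
Hypotheses (pi_lam : pi lam = lam) (lam_neq0 : lam != 0).
(* The z-adic filtration is separated, and its residue is seen by pi. *)
Hypothesis sep : forall r : {poly R}, r != 0 ->
  exists i r1, r = z ^+ i *: r1 /\ map_poly pi r1 != 0.

Lemma pseudo_reduce (H f : {poly R}) m a : lead_coef H * m = lam ^+ a ->
  exists N q r, lam ^+ N *: f = H * q + r /\ (size r < size H)%N.
Proof.
move=> lcH; have H0 : H != 0.
  rewrite -lead_coef_eq0; apply: contraNneq (expf_neq0 a lam_neq0) => lc0.
  by rewrite -lcH lc0 mul0r.
have := Pdiv.Idomain.divp_eq f H; set k := scalp f H => Ef.
exists (a * k)%N, (m ^+ k *: (f %/ H)), (m ^+ k *: (f %% H)); split.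
  rewrite exprM -lcH exprMn mulrC -scalerA Ef scalerDr scalerAl.
  by congr (_ + _); apply: mulrC.
by apply: leq_ltn_trans (size_scale_leq _ _) _; rewrite ltn_modp.
Qed.

(** Suppose H divides f g. As the leading coefficient of H divides a power of
    lam, f and g may be replaced by remainders r and t, of degree less than
    that of H. If both are nonzero, dividing r t = H u by the highest possible
    power of z and specializing gives r1 t1 = pi(H) u1 with r1 and t1 nonzero.
    Then pi(H) divides, up to lam, one of r1 and t1; it cannot, for it has the
    same degree as H. *)
Lemma quasi_prime_specialize (H : {poly R}) m a :
  lead_coef H * m = lam ^+ a ->
  quasi_prime lam%:P (map_poly pi H) -> quasi_prime lam%:P H.
Proof.
move=> lcH qpH f g [h Efg].
have [N [q [r [Ef sr]]]] := pseudo_reduce f lcH.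
have [M [p [t [Eg st]]]] := pseudo_reduce g lcH.
have [r0|r0] := eqVneq r 0.
  by exists N; left; exists q; rewrite -polyC_exp mul_polyC Ef r0 addr0.
have [t0|t0] := eqVneq t 0.
  by exists M; right; exists p; rewrite -polyC_exp mul_polyC Eg t0 addr0.
have [i [r1 [Er r1z]]] := sep r0; have [j [t1 [Et t1z]]] := sep t0.
have piH : pi (lead_coef H) != 0.
  apply: contraNneq (expf_neq0 a lam_neq0) => lc0.
  by rewrite -pi_lam -rmorphXn -lcH rmorphM lc0 mul0r.
have sH : size (map_poly pi H) = size H by rewrite size_map_poly_id0.
have pH0 : map_poly pi H != 0.
  by rewrite -size_poly_gt0 sH; apply: leq_ltn_trans sr.
have [u Ert] : divides H (r * t).
  (* r t = (lam^N f - H q) (lam^M g - H p), and H divides f g. *)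
  exists (lam ^+ N *: (lam ^+ M *: h) - q * (H * p + t) - r * p).
  have -> : r * t = (H * q + r) * (H * p + t) - H * (q * (H * p + t) + r * p) by ring.
  rewrite -Ef -Eg -scalerAl -scalerAr Efg !scalerAr -mulrBr; congr (_ * _).
  by rewrite opprD addrA.
have u0 : u != 0.
  by apply: contraTneq (mulf_neq0 r0 t0) => u0; rewrite Ert u0 mulr0 eqxx.
have [l [u1 [Eu u1z]]] := sep u0.
have Ez : z ^+ (i + j) *: (r1 * t1) = z ^+ l *: (H * u1).
  by rewrite [RHS]scalerAr -Eu -Ert Er Et -scalerAl -scalerAr scalerA exprD.
have zk (k : nat) (p1 : {poly R}) : map_poly pi (z ^+ k.+1 *: p1) = 0.
  by rewrite exprS -mul_polyC rmorphM /= map_polyC /= rmorphM pi_z mul0r polyC0 mul0r.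
have pir1t1 : map_poly pi (r1 * t1) != 0 by rewrite rmorphM mulf_neq0.
have piHu1 : map_poly pi (H * u1) != 0 by rewrite rmorphM mulf_neq0.
have scale_inj k (p1 p2 : {poly R}) : z ^+ k *: p1 = z ^+ k *: p2 -> p1 = p2.
  by rewrite -!mul_polyC; apply: mulfI; rewrite polyC_eq0 expf_neq0.
have {Ez} : r1 * t1 = H * u1.
  case: (ltngtP (i + j) l) Ez => [lt|gt|->]; last exact: scale_inj.
    rewrite -(subnKC (ltnW lt)) (exprD _ (i + j)) -scalerA => /scale_inj E.
    by move: pir1t1; rewrite E -(prednK (_ : 0 < l - (i + j)))%N ?subn_gt0 // zk eqxx.
  rewrite -(subnKC (ltnW gt)) exprD -scalerA => /scale_inj E.
  by move: piHu1; rewrite -E -(prednK (_ : 0 < i + j - l))%N ?subn_gt0 // zk eqxx.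
move/(congr1 (map_poly pi)); rewrite !rmorphM /= => E.
have size_lt (v : {poly R}) k v1 : (size v < size H)%N -> v = z ^+ k *: v1 ->
    (size (map_poly pi v1) < size H)%N.
  move=> sv Ev; apply: leq_ltn_trans (size_poly _ _) _.
  by move: sv; rewrite Ev size_scale // expf_neq0.
have no (v : {poly R}) k : (size v < size H)%N -> v != 0 ->
    ~ divides (map_poly pi H) (lam%:P ^+ k * v).
  move=> sv v0 [w Ew].
  have lv0 : lam%:P ^+ k * v != 0 by rewrite mulf_neq0 // expf_neq0 // polyC_eq0.
  have w0 : w != 0 by apply: contraNneq lv0 => w0; rewrite Ew w0 mulr0.
  have: size (lam%:P ^+ k * v) = size v.
    by rewrite -polyC_exp mul_polyC size_scale // expf_neq0.
  rewrite Ew size_mul // sH => E1; move: sv; rewrite -E1 ltnNge.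
  by rewrite -[size w]prednK ?size_poly_gt0 // addnS leq_addr.
by have [k [/(no _ _ (size_lt _ _ _ sr Er) r1z)|/(no _ _ (size_lt _ _ _ st Et) t1z)]] :=
  qpH _ _ (ex_intro _ _ E).
Qed.

End Specialize.

Section SpecializeVariable.
Variables (F : idomainType) (n : nat) (k : 'I_n) (c : F).
Local Notation R := {mpoly F[n]}.

Definition spec_var : {rmorphism R -> R} :=
  mmap (@mpolyC n F) (fun j => if j == k then c%:MP else 'X_j).

Lemma spec_varC a : spec_var a%:MP = a%:MP.
Proof. by rewrite /spec_var /= mmapC. Qed.

Lemma spec_varX j : spec_var 'X_j = if j == k then c%:MP else 'X_j.
Proof. by rewrite /spec_var /= mmapX mmap1U. Qed.

Lemma spec_var_decomp p : exists q, p = spec_var p + ('X_k - c%:MP) * q.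
Proof.
elim/mpoly_ring_ind: p => [a|j|p q [p1 Ep] [q1 Eq]|p q [p1 Ep] [q1 Eq]].
- by exists 0; rewrite spec_varC mulr0 addr0.
- rewrite spec_varX; case: eqP => [->|_]; last by exists 0; rewrite mulr0 addr0.
  by exists 1; rewrite mulr1 addrC subrK.
- by exists (p1 + q1); rewrite {1}Ep {1}Eq rmorphD mulrDr addrACA.
- exists (spec_var p * q1 + p1 * q); rewrite {1}Ep mulrDl {1}Eq rmorphM.
  by rewrite !mulrDr addrA mulrCA !mulrA.
Qed.

Lemma spec_var_root : spec_var ('X_k - c%:MP) = 0.
Proof. by rewrite rmorphB spec_varC spec_varX eqxx subrr. Qed.

Lemma msize_var_sub : (1 < msize ('X_k - c%:MP : R))%N.
Proof.
rewrite -(mdeg1 k); apply: msize_mdeg_lt.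
by rewrite mcoeff_msupp mcoeffB mcoeffX mcoeffC eqxx mnm1_eq0 mulr0 subr0 oner_eq0.
Qed.

Lemma var_sub_neq0 : 'X_k - c%:MP != 0 :> R.
Proof. by rewrite -msize_poly_eq0 -lt0n; apply: ltn_trans msize_var_sub. Qed.

(** The degree of the leading coefficient drops with each factor X_k - c that
    is extracted. *)
Lemma spec_var_valuation (r : {poly R}) : r != 0 ->
  exists i r1, r = ('X_k - c%:MP) ^+ i *: r1 /\ map_poly spec_var r1 != 0.
Proof.
have [m] := ubnP (msize (lead_coef r)); elim: m r => // m IHm r lt_rm r0.
have [pr0|] := eqVneq (map_poly spec_var r) 0; last first.
  by exists 0, r; rewrite expr0 scale1r.
have [q Er] : exists q, r = map_poly spec_var r + ('X_k - c%:MP) *: q.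
  elim/poly_ind: {IHm lt_rm r0 pr0} r => [|r a [q Eq]].
    by exists 0; rewrite rmorph0 scaler0 addr0.
  have [b Eb] := spec_var_decomp a; exists (q * 'X + b%:P).
  rewrite rmorphD rmorphM /= map_polyX map_polyC /= {1}Eq {1}Eb mulrDl.
  by rewrite scalerDr polyCD -scalerAl -!mul_polyC polyCM addrACA.
rewrite pr0 add0r in Er.
have q0 : q != 0 by apply: contraNneq r0 => q0; rewrite Er q0 scaler0.
have [||i [r1 [Eq Hr1]]] := IHm q => //; last first.
  by exists i.+1, r1; rewrite Er {1}Eq scalerA -exprS.
move: lt_rm; rewrite Er lead_coefZ msizeM ?lead_coef_eq0 ?var_sub_neq0 //.
move: msize_var_sub; case: (msize _) => [|[|s]] // _.
by rewrite ltnS !addSn /= => /(leq_trans _); apply; rewrite ltnS leq_addl.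
Qed.

End SpecializeVariable.

(** * Affine forms whose coefficients have no common zero *)

Section LinearPrime.
Variables (F : closedFieldType) (n d : nat) (h : 'I_d -> 'I_n).
Hypothesis inj_h : injective h.
Variables (g0 : {poly F}) (g : 'I_d -> {poly F}).
Local Notation R := {mpoly F[n]}.
Local Notation T := {poly R}.
Local Notation E := {fraction T}.
Local Notation coefs := (map_poly (@mpolyC n F)).

Definition linear_form : T := (coefs g0) + \sum_j coefs (g j) * ('X_(h j))%:P.
Local Notation G := linear_form.

Hypothesis G_no_root : forall a : F, G.[a%:MP] != 0.

Lemma divides_linear_factor a f : divides G (('X - a%:MP%:P) * f) -> divides G f.
Proof.
move=> [q Eq]; have : root q a%:MP.
  move/(congr1 (fun p => p.[a%:MP])): Eq; rewrite !hornerM hornerXsubC subrr mul0r.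
  by move/esym/eqP; rewrite mulf_eq0 => /orP [/eqP Ga0|//]; case/eqP: (G_no_root a).
case/factor_theorem => q1 Eq1; exists q1.
apply: (@mulfI _ ('X - a%:MP%:P)); first by rewrite polyXsubC_eq0.
by rewrite Eq Eq1; ring.
Qed.

(** A Gauss lemma: over an algebraically closed field it suffices to cancel
    factors y - a, and G does not vanish identically at y = a. *)
Lemma divides_coef_factor p f : p != 0 -> divides G ((coefs p) * f) -> divides G f.
Proof.
move=> p0; have [r ->] := closed_field_poly_normal p.
rewrite map_polyZ rmorph_prod /= -mul_polyC -mulrA => [[q Eq]].
have {q Eq} : divides G (\prod_(z <- r) coefs ('X - z%:P) * f).
  exists ((lead_coef p)^-1%:MP%:P * q); rewrite mulrCA -Eq !mulrA -polyCM -mpolyCM.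
  by rewrite mulVf ?lead_coef_eq0 // mul1r.
elim: r => [|z r IHr]; first by rewrite big_nil mul1r.
rewrite big_cons -mulrA rmorphB /= map_polyX map_polyC /= => /divides_linear_factor.
exact: IHr.
Qed.

Section Substitution.
Variable k : 'I_d.
Hypothesis gk0 : g k != 0.
Local Notation P := (coefs (g k)).

Let emb (a : T) : E := tofrac a.
Let slope : E := emb G / emb P.

Let P0 : P != 0.
Proof. by rewrite map_poly_eq0_id0 ?mpolyC_eq0 ?lead_coef_eq0. Qed.

Let embP0 : emb P != 0. Proof. by rewrite tofrac_eq0. Qed.

Let scalars : {rmorphism F -> E} := (@tofrac T) \o polyC \o (@mpolyC n F).

Let subst0 : {rmorphism R -> E} :=
  mmap scalars (fun i => emb ('X_i)%:P - (if i == h k then slope else 0)).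

(** Solving G = 0 for the variable x_k replaces it by x_k - G / P, where P is
    its coefficient in G. *)
Definition solve_var : {rmorphism T -> E} := horner_eval (emb 'X) \o map_poly subst0.

Lemma solve_varC a : solve_var a%:MP%:P = emb a%:MP%:P.
Proof. by rewrite /= map_polyC /horner_eval hornerC /= mmapC. Qed.

Lemma solve_var_polyX : solve_var 'X = emb 'X.
Proof. by rewrite /= map_polyX /horner_eval hornerX. Qed.

Lemma solve_varX i :
  solve_var ('X_i)%:P = emb ('X_i)%:P - (if i == h k then slope else 0).
Proof. by rewrite /= map_polyC /horner_eval hornerC /= mmapX mmap1U. Qed.

Lemma solve_var_coef p : solve_var (coefs p) = emb (coefs p).
Proof.
elim/poly_ring_ind: p => [a||p q Ep Eq|p q Ep Eq].
- by rewrite map_polyC; apply: solve_varC.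
- by rewrite map_polyX; apply: solve_var_polyX.
- by rewrite /emb !rmorphD Ep Eq.
- by rewrite /emb !rmorphM Ep Eq.
Qed.

Lemma solve_var_form : solve_var G = 0.
Proof.
rewrite /linear_form rmorphD solve_var_coef rmorph_sum.
under eq_bigr => j _ do rewrite rmorphM solve_var_coef solve_varX mulrBr.
rewrite big_split /= sumrN addrA.
rewrite [X in _ - X](bigD1 k) //= eqxx [X in _ - (_ + X)]big1 => [|j jk]; last first.
  by rewrite (inj_eq inj_h) (negPf jk) mulr0.
rewrite addr0 /slope mulrCA mulfV // mulr1 /linear_form /emb rmorphD rmorph_sum.
by under [X in _ - (_ + X)]eq_bigr => j _ do rewrite rmorphM; rewrite subrr.
Qed.

Lemma solve_var_clears f : clears (@tofrac T) solve_var idfun (divides G) P f.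
Proof.
have idI := ideal_principal G.
elim/poly_ring_ind: f => [r||f1 f2|f1 f2]; last 2 first.
- exact: clearsD.
- exact: clearsM.
- elim/mpoly_ring_ind: r => [a|i|r1 r2|r1 r2].
  + by apply: clears_cst; [apply: solve_varC | apply: ideal_congr_refl].
  + have [ik|ik] := eqVneq i (h k); last first.
      apply: clears_cst; last exact: ideal_congr_refl.
      by rewrite solve_varX (negPf ik) subr0.
    exists 1, (P * ('X_i)%:P - G); split; last by exists 1; rewrite expr1 /=; ring.
    rewrite expr1 solve_varX ik eqxx mulrBr mulrCA mulfV // mulr1.
    by rewrite rmorphB rmorphM.
  + by rewrite polyCD; apply: clearsD.
  + by rewrite polyCM; apply: clearsM.
- by apply: clears_cst; [apply: solve_var_polyX | apply: ideal_congr_refl].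
Qed.

Lemma solve_var_eq0 f : solve_var f = 0 -> divides G f.
Proof.
move=> f0; have [N [c [Ec]]] := solve_var_clears f.
move: Ec; rewrite f0 mulr0 => /esym/eqP; rewrite tofrac_eq0 => /eqP -> /=.
rewrite subr0 -rmorphXn; apply: divides_coef_factor; exact: expf_neq0.
Qed.

End Substitution.

(** The ideal of G is the kernel of [solve_var]: an element of the kernel
    becomes a multiple of G after multiplication by a power of the
    coefficient of x_k, and that power can be cancelled. Some x_k does occur,
    since otherwise G would be a nonconstant polynomial in y, with a root. *)
Lemma linear_form_prime f1 f2 : (1 < size G)%N ->
  divides G (f1 * f2) -> divides G f1 \/ divides G f2.
Proof.
move=> sG [q Eq]; have [k gk0] : exists k, g k != 0.
  apply/existsP; apply: contraLR sG => /existsPn g_eq0; rewrite -leqNgt.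
  have EG : G = (coefs g0).
    rewrite /linear_form big1 ?addr0 // => j _.
    by move: (g_eq0 j); rewrite negbK => /eqP ->; rewrite rmorph0 mul0r.
  rewrite EG (leq_trans (size_poly _ _)) // leqNgt; apply/negP => s1.
  have [a] := closed_rootP g0 (negbT (gtn_eqF s1)).
  move/rootP => ra; move: (G_no_root a).
  by rewrite EG horner_map ra rmorph0 eqxx.
have: solve_var k f1 * solve_var k f2 = 0.
  by rewrite -rmorphM Eq rmorphM solve_var_form //; apply: mul0r.
by move/eqP; rewrite mulf_eq0 => /orP [] /eqP /solve_var_eq0; auto.
Qed.

End LinearPrime.

(** * A Gram determinant identity, and uniform configurations *)

Lemma mulmx_diag_col (T : comNzRingType) (m : nat) (p : 'rV[T]_m) (v : 'cV_m) :
  diag_mx p *m v = \col_i (p 0 i * v i 0).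
Proof. by apply/matrixP => i j; rewrite mul_diag_mx !mxE ord1. Qed.

Lemma tr_mul_col (T : comNzRingType) (m : nat) (u v : 'cV[T]_m) :
  u^T *m v = (\sum_i u i 0 * v i 0)%:M.
Proof.
apply/matrixP => i j; rewrite !ord1 !mxE eqxx mulr1n.
by apply: eq_bigr => k _; rewrite mxE.
Qed.

Section GramIdentity.
Variables (T : comNzRingType) (d : nat).
Variables (A : 'M[T]_(d.+2, d)) (b c w : 'cV[T]_d.+2) (x : 'cV[T]_d).
Variables (p q : 'rV[T]_d.+2) (lam delta : T).
Let l := A *m x + b.
Hypothesis pl : forall i, p 0 i * l i 0 = lam * w i 0.
Hypothesis pq : forall i, p 0 i * q 0 i = delta.
Hypotheses (Aw : A^T *m w = 0) (bw : b^T *m w = 1%:M).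
Hypotheses (Ac : A^T *m c = 0) (bc : b^T *m c = 0).
Hypothesis det_c : forall v : 'cV_d.+2,
  \det (row_mx v (row_mx b A) : 'M_d.+2) = \sum_i c i 0 * v i 0.

Let L : 'M_(d.+2, 1 + d) := row_mx b A.
Let D := diag_mx p.

(** Since L (1, x) = l and D l = lam w, the vector L^T D L (1, x) is
    lam (1, 0, .., 0); Cramer's rule gives the value of the cofactor
    det (A^T D A). *)
Lemma det_gram_affine : \det (L^T *m D *m L) = lam * \det (A^T *m D *m A).
Proof.
have LDl : L^T *m (D *m l) = lam *: col_mx 1%:M 0.
  have -> : D *m l = lam *: w.
    by rewrite mulmx_diag_col; apply/matrixP => i j; rewrite ord1 [LHS]mxE [RHS]mxE pl.
  by rewrite -scalemxAr tr_row_mx mul_col_mx Aw bw.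
(* Multiplication by U replaces the column b of L by l = A x + b. *)
pose U : 'M_(1 + d) := block_mx 1%:M 0 x 1%:M.
have detU : \det U = 1 by rewrite det_lblock !det1 mulr1.
rewrite -[LHS]mulr1 -{}detU -det_mulmx -(mulmxA (L^T *m D)).
have -> : L *m U = row_mx l A.
  by rewrite mul_row_block !mulmx0 !mulmx1 add0r addrC.
rewrite mul_mx_row -(mulmxA L^T D l) LDl scale_col_mx scaler0 scale_scalar_mx mulr1.
rewrite [L^T *m D *m A](_ : _ = col_mx (b^T *m D *m A) (A^T *m D *m A)).
  by rewrite -block_mxEh det_ublock det_scalar1.
by rewrite tr_row_mx !mul_col_mx.
Qed.

(** Complete L = [b | A] to the square matrix N = [D^-1 c | L], with the
    inverse of D = diag p replaced by its multiple diag q. As c is orthogonal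
    to the columns of L, N^T D N is block diagonal, whereas det N = a. *)
Lemma gram_identity (a := \sum_i c i 0 ^+ 2 * q 0 i) :
  a ^+ 2 * \prod_i p 0 i = lam * \det (A^T *m D *m A) * (delta * a).
Proof.
rewrite -det_gram_affine.
pose v : 'cV_d.+2 := \col_i (q 0 i * c i 0).
pose N : 'M_(d.+2, 1 + (1 + d)) := row_mx v L.
have detN : \det (N : 'M_d.+2) = a.
  by rewrite det_c; apply: eq_bigr => i _; rewrite mxE mulrCA mulrC expr2.
have Dv : D *m v = delta *: c.
  by rewrite mulmx_diag_col; apply/matrixP => i j; rewrite !mxE ord1 mulrA pq.
have vD : v^T *m D = delta *: c^T.
  by apply: trmx_inj; rewrite trmx_mul tr_diag_mx trmxK Dv linearZ /= trmxK.
have Lc : L^T *m c = 0 by rewrite tr_row_mx mul_col_mx Ac bc col_mx0.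
have cL : c^T *m L = 0 by apply: trmx_inj; rewrite trmx_mul trmxK Lc trmx0.
have E : N^T *m D *m N = block_mx (delta * a)%:M 0 0 (L^T *m D *m L).
  rewrite tr_row_mx mul_col_mx vD mul_mx_row mul_col_mx -!scalemxAl.
  rewrite -[_ *m D *m v]mulmxA Dv -scalemxAr Lc scaler0 mul_col_mx -scalemxAl cL scaler0.
  rewrite block_mxEh; congr (row_mx (col_mx _ _) _).
  rewrite tr_mul_col scale_scalar_mx; congr (_ * _)%:M.
  by apply: eq_bigr => i _; rewrite mxE mulrCA mulrC expr2.
have := congr1 determinant E; rewrite det_ublock det_scalar1 mulrC => <-.
rewrite (det_mulmx (N^T *m D : 'M_d.+2) (N : 'M_d.+2)).
rewrite (det_mulmx (N^T : 'M_d.+2) (D : 'M_d.+2)) (det_tr (N : 'M_d.+2)) detN.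
by rewrite det_diag; ring.
Qed.

End GramIdentity.

Section UniformPencil.
Variables (F : fieldType).

Lemma uniform_colsub p q (M : 'M[F]_(p, q)) (g : 'I_p -> 'I_q) :
  (p <= q)%N -> uniform M -> injective g -> \det (colsub g M) != 0.
Proof.
move=> le_pq; rewrite /uniform (minn_idPl le_pq) => uM inj_g.
exact: uM (@inj_id _) inj_g.
Qed.

Lemma colsub_kernel p q (M : 'M[F]_(p, q)) (g : 'I_p -> 'I_q) (v : 'cV[F]_q) :
  injective g -> \det (colsub g M) != 0 -> M *m v = 0 ->
  (forall i, i \notin codom g -> v i 0 = 0) -> v = 0.
Proof.
move=> inj_g det0 Mv v_off.
have Mg : colsub g M *m rowsub g v = 0.
  rewrite -Mv; apply/matrixP => i j; rewrite !mxE [RHS](bigID (mem (codom g))) /=.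
  rewrite [X in _ + X]big1 ?addr0 => [|k kg]; last by rewrite ord1 v_off ?mulr0.
  have uniq_g : uniq (codom g) by rewrite codomE map_inj_uniq ?enum_uniq.
  rewrite -(big_uniq _ uniq_g) codomE big_map big_enum /=.
  by apply: eq_bigr => k _; rewrite !mxE.
have vg0 : rowsub g v = 0.
  have unitM : colsub g M \in unitmx by rewrite unitmxE unitfE.
  by rewrite -(mulKmx unitM (rowsub g v)) Mg mulmx0.
apply/matrixP => i j; rewrite ord1 mxE.
have [/codomP [k ->]|/v_off //] := boolP (i \in codom g).
by move/matrixP: vg0 => /(_ k 0); rewrite !mxE.
Qed.

Variables (d : nat) (A : 'M[F]_(d.+2, d)) (b : 'cV[F]_d.+2).
Hypotheses (uL : uniform (row_mx b A)^T) (uA : uniform A^T).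
Let L : 'M_(d.+2, 1 + d) := row_mx b A.

(** The cofactors of a first column added to L = [b | A]; they are the
    coefficients of the linear relation between the d + 2 affine forms. *)
Definition circuit : 'cV[F]_d.+2 :=
  \col_i cofactor (row_mx (0 : 'cV_d.+2) L : 'M_d.+2) i 0.

Lemma det_circuit (T : comNzRingType) (f : {rmorphism F -> T}) (v : 'cV[T]_d.+2) :
  \det (row_mx v (map_mx f L) : 'M_d.+2) = \sum_i f (circuit i 0) * v i 0.
Proof.
rewrite (expand_det_col _ 0); apply: eq_bigr => i _; rewrite mulrC; congr (_ * _).
  rewrite [circuit i 0]mxE /cofactor rmorphM rmorph_sign -det_map_mx.
  congr (_ * \det _); apply/matrixP => j k; rewrite !mxE.
  case: splitP => [k0|k0 _]; last by rewrite mxE.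
  by rewrite ord1 => /= /eqP; rewrite /bump leq0n add1n.
rewrite mxE; case: splitP => [k _|k]; first by rewrite ord1.
by [].
Qed.

Lemma affine_kernel0 (v : 'cV[F]_d.+2) i :
  A^T *m v = 0 -> b^T *m v = 0 -> v i 0 = 0 -> v = 0.
Proof.
move=> Av bv vi; have det0 := uniform_colsub (leqnSn _) uL (@lift_inj _ i).
have Lv : L^T *m v = 0 by rewrite tr_row_mx mul_col_mx Av bv col_mx0.
apply: colsub_kernel (@lift_inj _ i) det0 Lv _.
move=> j; have [->//|ij] := eqVneq j i.
by rewrite eq_sym in ij; case: (unlift_some ij) => k -> _; rewrite codom_f.
Qed.

Lemma linear_kernel0 (v : 'cV[F]_d.+2) i j : i != j ->
  A^T *m v = 0 -> v i 0 = 0 -> v j 0 = 0 -> v = 0.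
Proof.
move=> ij Av vi vj; case: (unlift_some ij) => k Ej _.
have inj_g : injective (lift i \o lift k) by apply: inj_comp; apply: lift_inj.
have det0 := uniform_colsub (leq_trans (leqnSn _) (leqnSn _)) uA inj_g.
apply: colsub_kernel inj_g det0 Av _ => r.
have [->//|ir] := eqVneq r i; rewrite eq_sym in ir.
case: (unlift_some ir) => r1 Er _.
have [Erk|rk] := eqVneq r1 k; first by rewrite Er Erk -Ej.
rewrite eq_sym in rk; case: (unlift_some rk) => r2 Er1 _.
by rewrite Er Er1 -[lift i _]/((lift i \o lift k) r2) codom_f.
Qed.

Lemma circuit_orth : A^T *m circuit = 0 /\ b^T *m circuit = 0.
Proof.
have Lc : L^T *m circuit = 0.
  apply/matrixP => k j; rewrite ord1 [RHS]mxE.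
  transitivity (\sum_i circuit i 0 * col k L i 0).
    by rewrite mxE; apply: eq_bigr => i _; rewrite mulrC; congr (_ * _); rewrite !mxE.
  have := det_circuit idfun (col k L); rewrite map_mx_id // => <-; rewrite -det_tr.
  apply: (@determinant_alternate _ _ _ 0 (rshift 1 k)) => // i.
  have -> : (0 : 'I_d.+2) = lshift (1 + d) (0 : 'I_1) by apply: val_inj.
  rewrite [LHS]mxE [RHS]mxE; apply: etrans (row_mxEl (col k L) L i 0) _.
  by rewrite mxE; apply: esym; apply: row_mxEr.
move: Lc; rewrite tr_row_mx mul_col_mx -(col_mx0 _ 1 d) => /eq_col_mx [? ?]; by [].
Qed.

(** The coefficients are, up to sign, the maximal minors of L. *)
Lemma circuit_neq0 i : circuit i 0 != 0.
Proof.
rewrite mxE /cofactor mulf_eq0 signr_eq0 /=.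
rewrite (_ : row' i _ = (colsub (lift i) L^T)^T).
  by rewrite det_tr; apply: (uniform_colsub (leqnSn _) uL (@lift_inj _ i)).
apply/matrixP => j k; rewrite 2!mxE [RHS]mxE [RHS]mxE [RHS]mxE.
have -> : lift 0 k = rshift 1 (k : 'I_(1 + d)) by apply: val_inj.
exact: row_mxEr.
Qed.

Lemma pencil_exists : exists e : 'cV[F]_d.+2, A^T *m e = 0 /\ b^T *m e = 1%:M.
Proof.
pose i0 : 'I_d.+2 := 0.
have det0 := uniform_colsub (leqnSn _) uL (@lift_inj _ i0).
have unitM : colsub (lift i0) L^T \in unitmx by rewrite unitmxE unitfE.
pose u : 'cV_(1 + d) := invmx (colsub (lift i0) L^T) *m col_mx 1%:M 0.
pose e : 'cV_d.+2 := \sum_k u k 0 *: delta_mx (lift i0 k) 0.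
have eE k : e (lift i0 k) 0 = u k 0.
  rewrite summxE (bigD1 k) //= big1 ?addr0 => [|j jk]; rewrite !mxE eqxx ?mulr1 //.
  by rewrite (inj_eq (@lift_inj _ i0)) eq_sym (negPf jk) mulr0.
have e0 : e i0 0 = 0.
  by rewrite summxE big1 // => j _; rewrite !mxE (negPf (neq_lift _ _)) mulr0.
have Le : L^T *m e = col_mx 1%:M 0.
  rewrite -[RHS](mulKVmx unitM) -/u; apply/matrixP => k j; rewrite ord1 !mxE.
  rewrite (bigD1_ord i0) //= e0 mulr0 add0r; apply: eq_bigr => r _.
  by rewrite eE !mxE.
by exists e; move: Le; rewrite tr_row_mx mul_col_mx => /eq_col_mx [? ?].
Qed.

Lemma circuit_exists : exists c : 'cV[F]_d.+2,
  [/\ forall (T : comNzRingType) (f : {rmorphism F -> T}) (v : 'cV[T]_d.+2),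
        \det (row_mx v (map_mx f (row_mx b A)) : 'M_d.+2) = \sum_i f (c i 0) * v i 0,
      forall i, c i 0 != 0, A^T *m c = 0 & b^T *m c = 0].
Proof.
exists circuit; have [Ac bc] := circuit_orth.
by split; [exact: det_circuit | exact: circuit_neq0 | |].
Qed.

Variables c e : 'cV[F]_d.+2.
Hypothesis c_neq0 : forall i, c i 0 != 0.
Hypotheses (Ac : A^T *m c = 0) (bc : b^T *m c = 0).
Hypotheses (Ae : A^T *m e = 0) (be : b^T *m e = 1%:M).

(** Otherwise c_i e - e_i c would be a nonzero element of ker A^T vanishing at
    i and j, against the uniformity of A. *)
Lemma pencil_independent i j : i != j -> c i 0 * e j 0 != c j 0 * e i 0.
Proof.
move=> ij; apply/eqP => E; have ci := c_neq0 i.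
pose v := c i 0 *: e - e i 0 *: c.
have v0 : v = 0.
  apply: (linear_kernel0 ij).
  - by rewrite mulmxBr -!scalemxAr Ae Ac !scaler0 subrr.
  - by rewrite !mxE mulrC subrr.
  - by rewrite !mxE E mulrC subrr.
have := congr1 (fun u => b^T *m u) v0.
rewrite mulmxBr -!scalemxAr be bc scaler0 subr0 mulmx0 scale_scalar_mx mulr1.
by move/matrixP => /(_ 0 0); rewrite !mxE eqxx => /eqP; rewrite (negPf ci).
Qed.

Lemma affine_kernel (v : 'cV[F]_d.+2) :
  A^T *m v = 0 -> b^T *m v = 0 -> exists g, v = g *: c.
Proof.
move=> Av bv.
exists (v 0 0 / c 0 0); apply/eqP; rewrite -subr_eq0; apply/eqP.
apply: (@affine_kernel0 _ 0).
- by rewrite mulmxBr -scalemxAr Av Ac scaler0 subrr.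
- by rewrite mulmxBr -scalemxAr bv bc scaler0 subrr.
- by rewrite !mxE divfK ?subrr // c_neq0.
Qed.

End UniformPencil.

(** * The Hessian along a pencil supported on d + 2 hyperplanes *)

(** Stated for arbitrary index sequences, so that it serves both the products
    of pencil coordinates and the terms of the Leibniz formula. *)
Lemma size_prod_linear (R : comNzRingType) (I : Type) (r : seq I) (p : I -> {poly R}) :
  (forall i, (size (p i) <= 2)%N) ->
  (size (\prod_(i <- r) p i)%R <= (size r).+1)%N /\
  (\prod_(i <- r) p i)`_(size r) = \prod_(i <- r) (p i)`_1.
Proof.
move=> sp; elim: r => [|i r [IHs IHc]].
  by rewrite !big_nil size_polyC coefC eqxx oner_eq0.
have Ep : p i = (p i)`_1 *: 'X + ((p i)`_0)%:P.
  apply/polyP => -[|[|k]]; rewrite coefD coefZ coefX coefC /= ?mulr0 ?mulr1 ?addr0 ?add0r //.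
  by rewrite nth_default // (leq_trans (sp i)).
rewrite !big_cons /=; split.
  apply: leq_trans (size_polyMleq _ _) _.
  by rewrite -ltnS; case: (size _ + _)%N (leq_add (sp i) IHs) => //= k; rewrite !ltnS.
rewrite {1}Ep mulrDl coefD -scalerAl coefZ coefXM /= mul_polyC coefZ.
by rewrite IHc [X in _ + _ * X]nth_default ?mulr0 ?addr0.
Qed.

Lemma det_linear_pencil (R : comNzRingType) (m : nat) (M N : 'M[R]_m) :
  let D := \det (\matrix_(i, j) ((M i j) *: 'X + (N i j)%:P)) in
  (size D <= m.+1)%N /\ D`_m = \det M.
Proof.
set P := \matrix_(i, j) _; move=> D.
have sP i j : (size (P i j) <= 2)%N.
  rewrite mxE (leq_trans (size_polyD _ _)) // geq_max.
  rewrite (leq_trans (size_scale_leq _ _)) ?size_polyX //.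
  by rewrite (leq_trans (size_polyC_leq1 _)).
have cP i j : (P i j)`_1 = M i j.
  by rewrite mxE coefD coefZ coefX coefC mulr1 addr0.
have Em : size (index_enum 'I_m) = m by rewrite -[RHS]size_enum_ord enumT.
have sgnP (s : 'S_m) : (-1) ^+ s = ((-1) ^+ s)%:P :> {poly R} by rewrite rmorph_sign.
have prodP (s : 'S_m) := size_prod_linear (index_enum 'I_m) (fun i => sP i (s i)).
split.
  apply: leq_trans (size_sum _ _ _) _; apply/bigmax_leqP => s _.
  rewrite sgnP mul_polyC (leq_trans (size_scale_leq _ _)) //.
  by have [] := prodP s; rewrite Em.
rewrite coef_sum; apply: eq_bigr => s _.
rewrite sgnP mul_polyC coefZ; congr (_ * _).
have [_] := prodP s; rewrite Em => ->.
by apply: eq_bigr => i _; rewrite cP.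
Qed.

Section Pencil.
Variables (F : closedFieldType) (d n : nat) (h : 'I_d -> 'I_n).
Hypothesis inj_h : injective h.
Variables (A : 'M[F]_(d.+2, d)) (b c e : 'cV[F]_d.+2).
Hypotheses (uL : uniform (row_mx b A)^T) (uA : uniform A^T).
Hypothesis det_c : forall (T : comNzRingType) (f : {rmorphism F -> T}) (v : 'cV[T]_d.+2),
  \det (row_mx v (map_mx f (row_mx b A)) : 'M_d.+2) = \sum_i f (c i 0) * v i 0.
Hypothesis c_neq0 : forall i, c i 0 != 0.
Hypotheses (Ac : A^T *m c = 0) (bc : b^T *m c = 0).
Hypotheses (Ae : A^T *m e = 0) (be : b^T *m e = 1%:M).
Local Notation R := {mpoly F[n]}.
Local Notation T := {poly R}.

Definition affine_form (i : 'I_d.+2) : R :=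
  \sum_j (A i j)%:MP * 'X_(h j) + (b i 0)%:MP.

Definition pencil_coord (i : 'I_d.+2) : {poly F} := c i 0 *: 'X + (e i 0)%:P.

Definition pencil_cofactor (i : 'I_d.+2) : {poly F} := \prod_(r | r != i) pencil_coord r.

Local Notation l := affine_form.
Local Notation w := pencil_coord.
Local Notation w' := pencil_cofactor.
Local Notation coefs := (map_poly (@mpolyC n F)).
Local Notation inj := (polyC \o @mpolyC n F).

Let W := \prod_i w i.

Definition pencil_form : T := \sum_i coefs (c i 0 ^+ 2 *: w' i) * (l i)%:P.
Local Notation G := pencil_form.

Lemma coord_cofactor i : w i * w' i = W.
Proof. by rewrite /W (bigD1 i). Qed.

Lemma coefsZ a p : coefs (a *: p) = inj a * coefs p.
Proof. by rewrite map_polyZ -mul_polyC. Qed.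

Lemma coefsM p q : coefs (p * q) = coefs p * coefs q.
Proof. exact: rmorphM. Qed.

Lemma injM x y : inj (x * y) = inj x * inj y.
Proof. by rewrite -rmorphM. Qed.

Lemma coefs_coord i : coefs (w i) = inj (c i 0) * 'X + inj (e i 0).
Proof. by rewrite rmorphD /= map_polyZ map_polyX map_polyC -mul_polyC. Qed.

Lemma sum_affine_form (v : 'cV[F]_d.+2) : A^T *m v = 0 ->
  \sum_i (v i 0)%:MP * l i = ((b^T *m v) 0 0)%:MP.
Proof.
move=> Av; under eq_bigr => i _ do rewrite mulrDr mulr_sumr.
rewrite big_split /= exchange_big big1 /= => [|j _].
  rewrite add0r mxE rmorph_sum; apply: eq_bigr => i _.
  by rewrite mxE mulrC rmorphM.
under eq_bigr => i _ do rewrite mulrA -rmorphM mulrC.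
rewrite -mulr_sumr -rmorph_sum; have /matrixP/(_ j 0) := Av.
rewrite !mxE; under eq_bigr => i _ do rewrite mxE mulrC.
by move=> ->; rewrite rmorph0 mulr0.
Qed.

Lemma affine_form_indep (v : 'cV[F]_d.+2) :
  \sum_i (v i 0)%:MP * l i = 0 -> A^T *m v = 0 /\ b^T *m v = 0.
Proof.
move=> lv0; have coef0 m : (\sum_i (v i 0)%:MP * l i)@_m = 0 by rewrite lv0 mcoeff0.
have coefl i m : ((v i 0)%:MP * l i)@_m =
    v i 0 * (\sum_j A i j * (U_(h j)%MM == m)%:R + b i 0 * (m == 0%MM)%:R).
  rewrite mcoeffCM mcoeffD mcoeffC raddf_sum; congr (_ * (_ + _)).
  by apply: eq_bigr => j _; rewrite /= mcoeffCM mcoeffX.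
split; apply/matrixP => j k; rewrite ord1 !mxE.
  have := coef0 U_(h j)%MM; rewrite raddf_sum /= => E.
  apply: etrans E; apply: eq_bigr => i _.
  rewrite mxE coefl mnm1_eq0 mulr0 addr0 mulrC (bigD1 j) //= eqxx mulr1.
  rewrite big1 ?addr0 // => r rj.
  by rewrite eq_mnm1 (inj_eq inj_h) (negPf rj) mulr0.
have := coef0 0%MM; rewrite raddf_sum /= => E.
apply: etrans E; apply: eq_bigr => i _.
rewrite mxE ord1 coefl eqxx mulr1 mulrC big1 ?add0r // => r _.
by rewrite mnm1_eq0 mulr0.
Qed.

Lemma pencil_form_linear :
  G = linear_form h (\sum_i (c i 0 ^+ 2 * b i 0) *: w' i)
        (fun j => \sum_i (c i 0 ^+ 2 * A i j) *: w' i).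
Proof.
have E i j : coefs ((c i 0 ^+ 2 * A i j) *: w' i) * ('X_(h j))%:P =
    coefs (c i 0 ^+ 2 *: w' i) * ((A i j)%:MP * 'X_(h j))%:P.
  rewrite !coefsZ (rmorphM inj) [in RHS]polyCM [RHS]mulrA; apply: (f_equal2 *%R) => //.
  exact: mulrAC.
rewrite /linear_form rmorph_sum.
under [X in _ = _ + X]eq_bigr => j _ do rewrite rmorph_sum mulr_suml.
under [X in _ = _ + X]eq_bigr => j _ do under eq_bigr => i _ do rewrite E.
rewrite [X in _ = _ + X]exchange_big -big_split /=; apply: eq_bigr => i _.
rewrite -mulr_sumr -rmorph_sum rmorphD mulrDr addrC; apply: (f_equal2 +%R) => //.
by rewrite !coefsZ [in RHS](rmorphM inj); apply: mulrAC.
Qed.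

(** If G vanished identically in x at y = a, the vector k_i = c_i^2 w'_i(a)
    would be a relation between the l_i, hence k = g c. If some w_i(a) is zero
    then g = 0, and a second coordinate w_r(a) vanishes too, which makes
    (c_i, e_i) and (c_r, e_r) proportional. If no w_i(a) is zero, c is
    proportional to w(a) = a c + e, which b^T c = 0 and b^T e = 1 forbid. *)
Lemma pencil_form_no_root (a : F) : G.[a%:MP] != 0.
Proof.
apply/eqP => Ga0.
pose k : 'cV[F]_d.+2 := \col_i (c i 0 ^+ 2 * (w' i).[a]).
have : \sum_i (k i 0)%:MP * l i = 0.
  apply: etrans Ga0; rewrite /pencil_form horner_sum; apply: eq_bigr => i _.
  by rewrite hornerM hornerC horner_map mxE /= hornerZ.
case/affine_form_indep => Ak bk; have [g Eg] := affine_kernel uL c_neq0 Ac bc Ak bk.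
have Eg' i : c i 0 * (w' i).[a] = g.
  apply: (mulfI (c_neq0 i)); rewrite mulrA -expr2 mulrC [RHS]mulrC.
  by move/matrixP: Eg => /(_ i 0); rewrite !mxE mulrC.
have wE i : (w i).[a] = c i 0 * a + e i 0 by rewrite hornerD hornerZ hornerX hornerC.
have [/existsP [i /eqP wi0]|] := boolP [exists i, (w i).[a] == 0].
  have [j ji] : exists j : 'I_d.+2, j != i by exists (lift i 0); rewrite eq_sym neq_lift.
  have g0 : g = 0.
    rewrite -(Eg' j) /pencil_cofactor horner_prod (bigD1 i) 1?eq_sym //=.
    by rewrite wi0 mul0r mulr0.
  have := Eg' i; rewrite g0 => /eqP; rewrite mulf_eq0 (negPf (c_neq0 i)) /=.
  rewrite /pencil_cofactor horner_prod => /prodf_eq0 [r ri /eqP wr0].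
  move: (pencil_independent uA c_neq0 Ac bc Ae be ri).
  have e_root t : (w t).[a] = 0 -> e t 0 = - (c t 0 * a).
    by rewrite wE => /eqP; rewrite addrC addr_eq0 => /eqP.
  by rewrite (e_root _ wi0) (e_root _ wr0) !mulrN mulrCA eqxx.
move=> /existsPn w0; have EW i : c i 0 * W.[a] = g * (w i).[a].
  by rewrite -(coord_cofactor i) hornerM -(Eg' i) -mulrA [_ * (w i).[a]]mulrC.
have Ec : (W.[a] - g * a) *: c = g *: e.
  apply/matrixP => i j; rewrite ord1 !mxE mulrBl mulrC EW wE; ring.
have := congr1 (fun u => b^T *m u) Ec.
rewrite -!scalemxAr bc be scaler0 => /matrixP/(_ 0 0); rewrite !mxE eqxx mulr1 => g0.
have := EW 0; rewrite -g0 mul0r => /eqP; rewrite mulf_eq0 (negPf (c_neq0 0)) /=.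
by rewrite horner_prod => /prodf_eq0 [i _]; rewrite (negPf (w0 i)).
Qed.

Lemma size_coord i : (size (w i) <= 2)%N.
Proof.
rewrite (leq_trans (size_polyD _ _)) // geq_max (leq_trans (size_scale_leq _ _)) ?size_polyX //.
by rewrite (leq_trans (size_polyC_leq1 _)).
Qed.

Lemma size_cofactor i : (size (w' i) <= d.+2)%N.
Proof.
apply: leq_trans (size_prod_leq _ _) _.
rewrite (eq_card (_ : _ =i predC1 i)) // cardC1 card_ord /=.
rewrite leq_subLR addnS ltnS.
apply: leq_trans (leq_sum _ (fun r _ => size_coord r)) _.
rewrite sum_nat_const (eq_card (_ : _ =i predC1 i)) // cardC1 card_ord /=.
by rewrite muln2 -addnn.
Qed.

(** From c_i y = w_i - e_i, sum c_i l_i = 0 and sum e_i l_i = 1 one gets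
    y^2 G = sum_i e_i^2 l_i w'_i - prod_i w_i, where the sum has degree at most
    d + 1 in y. *)
Lemma pencil_form_coef j : (d <= j)%N ->
  G`_j = if j == d then (- \prod_i c i 0)%:MP else 0.
Proof.
move=> dj; pose S (a : 'I_d.+2 -> F) : T := \sum_i coefs (a i *: w' i) * (l i)%:P.
have shift (u : 'cV[F]_d.+2) : A^T *m u = 0 ->
    'X * S (fun i => u i 0 * c i 0) =
    coefs W * inj ((b^T *m u) 0 0) - S (fun i => u i 0 * e i 0).
  move=> Au; apply/eqP; rewrite eq_sym subr_eq eq_sym; apply/eqP.
  rewrite /S mulr_sumr -big_split /= -sum_affine_form // rmorph_sum mulr_sumr.
  apply: eq_bigr => i _; rewrite !coefsZ -(coord_cofactor i).
  rewrite coefsM coefs_coord !injM /= polyCM.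
  move: (u i 0)%:MP%:P (c i 0)%:MP%:P (e i 0)%:MP%:P (coefs (w' i)) => a1 a2 a3 w1.
  by ring.
have E1 : 'X * ('X * G) = S (fun i => e i 0 * e i 0) - coefs W.
  have -> : G = S (fun i => c i 0 * c i 0) by apply: eq_bigr => i _; rewrite expr2.
  rewrite shift // bc !mxE rmorph0 mulr0 sub0r.
  have -> : S (fun i => c i 0 * e i 0) = S (fun i => e i 0 * c i 0).
    by apply: eq_bigr => i _; rewrite [c i 0 * _]mulrC.
  by rewrite mulrN shift // be !mxE eqxx rmorph1 mulr1 opprB.
have -> : G`_j = ('X * ('X * G))`_j.+2 by rewrite !coefXM.
rewrite E1 coefB /S coef_sum big1 ?sub0r => [|i _]; last first.
  rewrite coefMC nth_default ?mul0r // (leq_trans (size_poly _ _)) //.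
  by rewrite (leq_trans (size_scale_leq _ _)) // (leq_trans (size_cofactor i)).
have [sW cW] := size_prod_linear (index_enum 'I_d.+2) size_coord.
move: sW cW; have -> : size (index_enum 'I_d.+2) = d.+2 by rewrite -[RHS]size_enum_ord enumT.
rewrite coef_map /= -/W => sW cW; case: eqP => [->|/eqP jd].
  rewrite cW rmorphN; congr (- _%:MP); apply: eq_bigr => i _.
  by rewrite coefD coefZ coefX coefC mulr1 addr0.
by rewrite nth_default ?rmorph0 ?oppr0 // (leq_trans sW) // !ltnS ltn_neqAle eq_sym jd.
Qed.

Lemma prod_c_neq0 : \prod_i c i 0 != 0.
Proof. by apply/prodf_neq0 => i _. Qed.

Lemma size_pencil_form : size G = d.+1.
Proof.
apply/eqP; rewrite eqn_leq; apply/andP; split.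
  by apply/leq_sizeP => j dj; rewrite pencil_form_coef ?(ltnW dj) // gtn_eqF.
rewrite ltnNge; apply/negP => /leq_sizeP /(_ d (leqnn _)) /eqP.
by rewrite pencil_form_coef // eqxx mpolyC_eq0 oppr_eq0 (negPf prod_c_neq0).
Qed.

Variables (lam : R) (hat : 'I_d.+2 -> R).
Hypothesis lam_neq0 : lam != 0.
Hypothesis hatl : forall i, hat i * l i = lam.

Definition pencil_hessian : T :=
  \det ((map_mx inj A)^T *m diag_mx (\row_i (coefs (w i) * (hat i)%:P)) *m map_mx inj A).
Local Notation H := pencil_hessian.

(** [gram_identity] with p_i = w_i hat_i and q_i = w'_i l_i, after
    cancellation of G and of the product of all w_i. *)
Lemma pencil_hessianE : lam%:P ^+ 2 * H = G * \prod_i (hat i)%:P.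
Proof.
have coefsW0 : coefs W != 0.
  rewrite map_poly_eq0_id0 ?mpolyC_eq0 ?lead_coef_eq0; apply/prodf_neq0 => i _;
    apply/eqP => /polyP /(_ 1); rewrite coefD coefZ coefX coefC coef0 mulr1 addr0;
    by move/eqP; rewrite (negPf (c_neq0 i)).
have G0 : G != 0 by rewrite -size_poly_eq0 size_pencil_form.
pose wv : 'cV[T]_d.+2 := \col_i coefs (w i).
have Ewv : wv = 'X *: map_mx inj c + map_mx inj e.
  by apply/matrixP => i j; rewrite !mxE ord1 coefs_coord mulrC.
have := @gram_identity T d (map_mx inj A) (map_mx inj b) (map_mx inj c) wv
  (\col_j ('X_(h j))%:P) (\row_i (coefs (w i) * (hat i)%:P))
  (\row_i (coefs (w' i) * (l i)%:P)) lam%:P (lam%:P * coefs W).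
set a := \sum_i _; have -> : a = G.
  by apply: eq_bigr => i _; rewrite !mxE coefsZ rmorphXn mulrA.
move=> E.
have {}E : G ^+ 2 * \prod_i (\row_i (coefs (w i) * (hat i)%:P)) 0 i =
   lam%:P * H * (lam%:P * coefs W * G).
  apply: E.
  - move=> i; rewrite !mxE -(hatl i) polyCM.
    under eq_bigr => j _ do rewrite !mxE.
    rewrite /affine_form [in RHS]rmorphD /= rmorph_sum /=.
    under [in RHS]eq_bigr => j _ do rewrite polyCM.
    by ring.
  - move=> i; rewrite [X in X * _]mxE [X in _ * X]mxE.
    have -> : coefs W = coefs (w i) * coefs (w' i) by rewrite -coefsM coord_cofactor.
    have -> : lam%:P = (hat i)%:P * (l i)%:P by rewrite -polyCM hatl.
    move: (coefs (w i)) (coefs (w' i)) (hat i)%:P (l i)%:P => p1 p2 p3 p4.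
    by rewrite mulrACA mulrC.
  - rewrite Ewv mulmxDr -scalemxAr !map_trmx -!map_mxM Ac Ae map_mx0 scaler0 addr0.
    by [].
  - rewrite Ewv mulmxDr -scalemxAr !map_trmx -!map_mxM bc be map_mx0 scaler0 add0r.
    by rewrite map_mx1.
  - by rewrite map_trmx -map_mxM Ac map_mx0.
  - by rewrite map_trmx -map_mxM bc map_mx0.
  - by move=> v; rewrite -map_row_mx det_c; apply: eq_bigr => i _; rewrite mxE.
apply: (mulfI coefsW0); apply: (mulfI G0); move: E.
under eq_bigr => i _ do rewrite mxE.
rewrite big_split /= -rmorph_prod /= -/W => E.
transitivity (lam%:P * H * (lam%:P * coefs W * G)); first by ring.
by rewrite -E; ring.
Qed.

Lemma prod_hat : \prod_i hat i * \prod_i l i = lam ^+ d.+2.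
Proof.
rewrite -big_split /=; under eq_bigr => i _ do rewrite hatl.
by rewrite prodr_const card_ord.
Qed.

Lemma pencil_hessian_coef :
  H`_d * (lam ^+ 2 * (- (\prod_i c i 0)^-1)%:MP * \prod_i l i) = lam ^+ d.+2.
Proof.
have := congr1 (fun p : T => p`_d) pencil_hessianE.
rewrite -rmorphXn -rmorph_prod /= coefCM coefMC pencil_form_coef // eqxx => E.
transitivity ((lam ^+ 2 * H`_d) * ((- (\prod_i c i 0)^-1)%:MP * \prod_i l i)); first by ring.
rewrite E -prod_hat.
transitivity (((- \prod_i c i 0)%:MP * (- (\prod_i c i 0)^-1)%:MP) * (\prod_i hat i * \prod_i l i)).
  by ring.
by rewrite -rmorphM mulrNN mulfV ?prod_c_neq0 // mul1r.
Qed.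

(** G is prime, and [pencil_hessianE] compares H and G up to divisors of powers
    of lam. *)
Lemma pencil_hessian_quasi_prime : (0 < d)%N -> quasi_prime lam%:P H.
Proof.
move=> d0 f g [q Eq].
have reduce p : divides G p -> exists M, divides H (lam%:P ^+ M * p).
  move=> [u ->]; exists d.+2; exists (lam%:P ^+ 2 * \prod_i (l i)%:P * u).
  have := congr1 polyC prod_hat; rewrite rmorphM !rmorph_prod rmorphXn /= => <-.
  transitivity ((G * \prod_i (hat i)%:P) * (\prod_i (l i)%:P * u)); first by ring.
  by rewrite -pencil_hessianE; ring.
have : divides G ((lam%:P ^+ 2 * f) * g).
  exists (\prod_i (hat i)%:P * q); rewrite mulrA -pencil_hessianE -mulrA Eq; ring.
rewrite pencil_form_linear; case/linear_form_prime => //.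
- by rewrite -pencil_form_linear; apply: pencil_form_no_root.
- by rewrite -pencil_form_linear size_pencil_form.
- rewrite -pencil_form_linear => /reduce [M]; rewrite mulrA -exprD => Hf.
  by exists (M + 2)%N; left.
- by rewrite -pencil_form_linear => /reduce [M HM]; exists M; right.
Qed.

End Pencil.

(** * The Hessian on the whole kernel of the transpose of A *)

Section Hessian.
Variables (F : closedFieldType) (n d : nat).
Variables (A : 'M[F]_(n.+1, d)) (b : 'cV[F]_n.+1) (s : 'I_d.+2 -> 'I_n.+1).
Local Notation As := (rowsub s A).
Local Notation bs := (rowsub s b).
Variables (c e : 'cV[F]_d.+2) (Y : 'M[F]_(n.+1, d)).
Local Notation R := {mpoly F[d + n.+1]}.
Local Notation T := {poly R}.
Local Notation inj := (polyC \o @mpolyC (d + n.+1) F).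
Local Notation coefs := (map_poly (@mpolyC (d + n.+1) F)).

Definition coord_form (i : 'I_n.+1) : R :=
  \sum_j (A i j)%:MP * 'X_(lshift n.+1 j) + (b i 0)%:MP.
Local Notation l := coord_form.

Definition coord_prod : R := \prod_i l i.
Local Notation lam := coord_prod.

Definition coord_cofactor_prod (i : 'I_n.+1) : R := \prod_(k | k != i) l k.
Local Notation hat := coord_cofactor_prod.

Definition extend (u : 'cV[F]_d.+2) : 'cV[F]_n.+1 :=
  \col_i \sum_t (i == s t)%:R * u t 0.

Definition kernel_proj : 'M[F]_n.+1 := 1%:M - Y *m A^T.
Local Notation P := kernel_proj.

(** The general point y c + P v of ker A^T. *)
Definition weight (v : 'I_n.+1 -> R) (i : 'I_n.+1) : T :=
  (extend c i 0)%:MP *: 'X + (\sum_k (P i k)%:MP * v k)%:P.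

(** det (A^T diag (w / l) A), multiplied by lam^d to clear denominators. *)
Definition hessian_form (v : 'I_n.+1 -> R) : T :=
  \det (\matrix_(j, k) \sum_i inj (A i j * A i k) * (weight v i * (hat i)%:P)).
Local Notation H := hessian_form.

Lemma hat_coord i : hat i * l i = lam.
Proof. by rewrite mulrC /coord_prod (bigD1 i). Qed.

Lemma sum_extend (K : comNzRingType) (f : {rmorphism F -> K}) (u : 'cV[F]_d.+2) (g : 'I_n.+1 -> K) :
  \sum_i g i * f (extend u i 0) = \sum_t g (s t) * f (u t 0).
Proof.
under eq_bigr => i _ do rewrite mxE rmorph_sum mulr_sumr.
rewrite exchange_big; apply: eq_bigr => t _ /=.
rewrite (bigD1 (s t)) //= eqxx mul1r big1 ?addr0 // => i /negPf ->.
by rewrite mul0r rmorph0 mulr0.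
Qed.

Lemma extend_mul m (M : 'M[F]_(n.+1, m)) (u : 'cV[F]_d.+2) :
  M^T *m extend u = (rowsub s M)^T *m u.
Proof.
apply/matrixP => i j; rewrite ord1 !mxE.
have := sum_extend idfun u (fun k => M k i) => /= E.
transitivity (\sum_k M k i * extend u k 0); first by apply: eq_bigr => k _; rewrite mxE.
by rewrite E; apply: eq_bigr => k _; rewrite !mxE.
Qed.

Let lc := \det (\matrix_(j, k) \sum_i (A i j * A i k * extend c i 0)%:MP * hat i : 'M[R]_d).

(** The coefficient of y^d depends only on c, so it may be computed at v = e. *)
Lemma hessian_form_lc v : (size (H v) <= d.+1)%N /\ (H v)`_d = lc.
Proof.
pose M : 'M[R]_d := \matrix_(j, k) \sum_i (A i j * A i k * extend c i 0)%:MP * hat i.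
pose N : 'M[R]_d := \matrix_(j, k) \sum_i (A i j * A i k)%:MP * (\sum_r (P i r)%:MP * v r) * hat i.
rewrite (_ : H v = \det (\matrix_(j, k) (M j k *: 'X + (N j k)%:P))).
  exact: det_linear_pencil.
congr (\det _); apply/matrixP => j k; rewrite !mxE.
rewrite scaler_suml rmorph_sum -big_split /=; apply: eq_bigr => i _.
rewrite /weight -!mul_polyC !rmorphM /=; ring.
Qed.

Lemma map_hessian_form (pi : {rmorphism R -> R}) v :
  (forall a, pi a%:MP = a%:MP) -> (forall j, pi 'X_(lshift n.+1 j) = 'X_(lshift n.+1 j)) ->
  map_poly pi (H v) = H (fun i => pi (v i)) /\ pi lam = lam.
Proof.
move=> piC piX; have pil i : pi (l i) = l i.
  rewrite rmorphD rmorph_sum piC; congr (_ + _); apply: eq_bigr => j _.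
  by rewrite rmorphM piC piX.
have pihat i : pi (hat i) = hat i by rewrite rmorph_prod; apply: eq_bigr.
split; last by rewrite rmorph_prod; apply: eq_bigr.
rewrite -det_map_mx; congr (\det _); apply/matrixP => j k.
have mapM (p q : T) : map_poly pi (p * q) = map_poly pi p * map_poly pi q.
  exact: rmorphM.
have mapD (p q : T) : map_poly pi (p + q) = map_poly pi p + map_poly pi q.
  exact: rmorphD.
have map_sum (p : 'I_n.+1 -> T) : map_poly pi (\sum_i p i) = \sum_i map_poly pi (p i).
  exact: rmorph_sum.
rewrite 2![in LHS]mxE [RHS]mxE; apply: etrans (map_sum _) _; apply: eq_bigr => i _.
rewrite !mapM /= !(map_polyC pi) /= pihat piC; apply: (f_equal2 *%R) => //.
apply: (f_equal2 *%R) => //.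
rewrite /weight mapD map_polyZ map_polyX map_polyC /= piC; apply: (f_equal2 +%R) => //.
rewrite rmorph_sum; under [in LHS]eq_bigr => r _ do rewrite rmorphM piC.
by [].
Qed.

Hypothesis row_neq0 : forall i, row i A != 0.

Lemma coord_form_neq0 i : l i != 0.
Proof.
apply: contraNneq (row_neq0 i) => li0; apply/eqP/rowP => j; rewrite !mxE.
have := congr1 (mcoeff U_(lshift n.+1 j)%MM) li0.
rewrite mcoeff0 mcoeffD mcoeffC mnm1_eq0 mulr0 addr0 raddf_sum (bigD1 j) //=.
rewrite mcoeffCM mcoeffX eqxx mulr1 big1 ?addr0 // => r rj.
by rewrite mcoeffCM mcoeffX eq_mnm1 (inj_eq (@lshift_inj _ _)) (negPf rj) mulr0.
Qed.

Lemma coord_prod_neq0 : lam != 0.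
Proof. by apply/prodf_neq0 => i _; apply: coord_form_neq0. Qed.

Hypothesis d_gt0 : (0 < d)%N.
Hypotheses (uL : uniform (row_mx bs As)^T) (uA : uniform As^T).
Hypothesis det_c : forall (T : comNzRingType) (f : {rmorphism F -> T}) (v : 'cV[T]_d.+2),
  \det (row_mx v (map_mx f (row_mx bs As)) : 'M_d.+2) = \sum_i f (c i 0) * v i 0.
Hypothesis c_neq0 : forall i, c i 0 != 0.
Hypotheses (Ac : As^T *m c = 0) (bc : bs^T *m c = 0).
Hypotheses (Ae : As^T *m e = 0) (be : bs^T *m e = 1%:M).

Lemma proj_extend u : As^T *m u = 0 -> P *m extend u = extend u.
Proof.
by move=> Au; rewrite mulmxBl mul1mx -mulmxA extend_mul Au mulmx0 subr0.
Qed.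

Let e_cst i : R := (extend e i 0)%:MP.

Lemma hessian_form_pencil : H e_cst =
  pencil_hessian As c e (fun t => hat (s t)).
Proof.
congr (\det _); apply/matrixP => j k; rewrite mxE mul_mx_diag mxE.
have wE i : weight e_cst i = inj (extend c i 0) * 'X + inj (extend e i 0).
  rewrite /weight -mul_polyC /=; congr (_ + _%:P).
  have /matrixP/(_ i 0) := proj_extend Ae; rewrite mxE => <-.
  by rewrite rmorph_sum; apply: eq_bigr => r _; rewrite rmorphM.
pose g i : T := inj (A i j * A i k) * (hat i)%:P.
transitivity (\sum_i (g i * 'X) * inj (extend c i 0) + \sum_i g i * inj (extend e i 0)).
  by rewrite -big_split /=; apply: eq_bigr => i _; rewrite wE /g /=; ring.
have E1 := sum_extend (inj : {rmorphism F -> T}) c (fun i => g i * 'X).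
have E2 := sum_extend (inj : {rmorphism F -> T}) e g.
apply: etrans (f_equal2 +%R E1 E2) _.
rewrite -big_split; apply: eq_bigr => t _ /=.
have gE : g (s t) = inj (As t j) * inj (As t k) * (hat (s t))%:P.
  by rewrite /g -injM ![rowsub _ _ _ _]mxE.
have -> : (\matrix_(r, i) ((map_mx inj As)^T r i *
    (\row_i' (coefs (pencil_coord c e i') * (hat (s i'))%:P)) 0 i)) j t =
    inj (As t j) * (coefs (pencil_coord c e t) * (hat (s t))%:P).
  by rewrite mxE; apply: (f_equal2 *%R); rewrite mxE // mxE.
have -> : map_mx inj As t k = inj (As t k) by rewrite mxE.
rewrite gE coefs_coord /=.
move: (hat (s t))%:P (As t j)%:MP%:P (As t k)%:MP%:P (c t 0)%:MP%:P (e t 0)%:MP%:P.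
by move=> a0 a1 a2 a3 a4; ring.
Qed.

Let hatl t : hat (s t) * affine_form (@lshift d n.+1) As bs t = lam.
Proof.
rewrite -[RHS](hat_coord (s t)); congr (_ * (_ + _)); last by rewrite mxE.
by apply: eq_bigr => j _; rewrite mxE.
Qed.

Lemma lead_coef_hessian_form v :
  size (H v) = d.+1 /\ exists m, lead_coef (H v) * m = lam ^+ d.+2.
Proof.
have [sH cH] := hessian_form_lc v; have [_ ce] := hessian_form_lc e_cst.
have := pencil_hessian_coef det_c c_neq0 Ac bc Ae be hatl.
rewrite -hessian_form_pencil ce; set m := (_ * _ * _) => E.
have lc0 : lc != 0.
  by apply: contraNneq (expf_neq0 d.+2 coord_prod_neq0) => lc0; rewrite -E lc0 mul0r.
have sHd : size (H v) = d.+1.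
  apply/eqP; rewrite eqn_leq sH ltnNge; apply/negP => /leq_sizeP /(_ d (leqnn _)).
  by rewrite cH => /eqP; rewrite (negPf lc0).
by split=> //; exists m; rewrite lead_coefE sHd /= cH.
Qed.

(* The coordinates of v are specialized to those of e one after the other. *)
Let v_step k (i : 'I_n.+1) : R := if (i < k)%N then e_cst i else 'X_(rshift d i).

Lemma hessian_form_quasi_prime :
  quasi_prime lam%:P (H (fun i => 'X_(rshift d i))).
Proof.
suff qp m k : (m + k = n.+1)%N -> quasi_prime lam%:P (H (v_step k)).
  by apply: (qp n.+1 0%N); rewrite addn0.
elim: m k => [|m IHm] k Ek.
  rewrite add0n in Ek.
  have -> : H (v_step k) = H e_cst.
    by apply: f_equal; apply: boolp.funext => i; rewrite /v_step Ek ltn_ord.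
  rewrite hessian_form_pencil.
  exact: (pencil_hessian_quasi_prime (@lshift_inj _ _) uL uA det_c c_neq0 Ac bc Ae be hatl).
have kn : (k < n.+1)%N by rewrite -Ek addSn ltnS leq_addl.
pose i0 := Ordinal kn; pose pi := spec_var (rshift d i0) (extend e i0 0).
have piC a : pi a%:MP = a%:MP by apply: spec_varC.
have piX j : pi 'X_(lshift n.+1 j) = 'X_(lshift n.+1 j).
  by rewrite /pi spec_varX eq_lrshift.
have [piH pilam] := map_hessian_form (v_step k) piC piX.
have [_ [m' lcH]] := lead_coef_hessian_form (v_step k).
apply: (quasi_prime_specialize (spec_var_root _ _) (var_sub_neq0 _ _) pilam
  coord_prod_neq0 (@spec_var_valuation _ _ _ _) lcH).
rewrite -/pi piH.
have -> : H (fun i => pi (v_step k i)) = H (v_step k.+1); last by apply: IHm; rewrite -addSnnS.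
apply: f_equal; apply: boolp.funext => i; rewrite /v_step ltnS.
case: (ltngtP i k) => [lt|gt|eq].
- exact: piC.
- by rewrite /pi spec_varX (inj_eq (@rshift_inj _ _)) -val_eqE /= (gtn_eqF gt).
- have -> : i = i0 by apply: val_inj.
  by rewrite /pi spec_varX eqxx.
Qed.

End Hessian.

(** * The ramification ideal is prime *)

Section RamHomogeneous.
Variables (F : fieldType) (n d : nat) (A : 'M[F]_(n.+1, d)) (b : 'cV[F]_n.+1).
Local Notation Q := {mpoly F[d.+1]}.
Local Notation S := {mpoly Q[n.+1]}.

Lemma log_gradientE k : log_gradient A b k 0 =
  \sum_i (A i k)%:MP%:MP * ((inv_ell A b i)%:MP * 'X_i).
Proof.
rewrite /log_gradient mul_mx_diag mxE; apply: eq_bigr => i _.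
by rewrite !mxE -mulrA.
Qed.

Lemma log_hessianE j k : log_hessian A b j k =
  \sum_i (A i j)%:MP%:MP * (A i k)%:MP%:MP * ((inv_ell A b i ^+ 2)%:MP * 'X_i).
Proof.
rewrite /log_hessian mul_mx_diag mxE; apply: eq_bigr => i _.
by rewrite !mxE mulrAC.
Qed.

Lemma homogC k (q : Q) (p : S) : p \is k.-homog -> q%:MP * p \is k.-homog.
Proof. by move=> homp; rewrite mul_mpolyC; apply: rpredZ. Qed.

Lemma homogX i : ('X_i : S) \is 1.-homog.
Proof. by rewrite dhomogX /= mdeg1. Qed.

Lemma homog_prod_linear m (p : 'I_m -> S) :
  (forall i, p i \is 1.-homog) -> \prod_i p i \is m.-homog.
Proof.
elim: m p => [|m IHm] p homp; first by rewrite big_ord0; apply: dhomog1.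
by rewrite big_ord_recl; apply: (@dhomogM _ _ _ 1 _ m) => //; apply: IHm.
Qed.

Lemma Ram_homog : homog_ideal (Ram A b).
Proof.
apply: homog_ideal_gen => g [->|[k ->]|->].
- exists 0%N; rewrite -[X in X \is _]mulr1; apply: homogC; exact: dhomog1.
- exists 1; rewrite log_gradientE; apply: rpred_sum => i _.
  by do 2 apply: homogC; apply: homogX.
- exists d; apply: rpred_sum => s _.
  have -> : (-1) ^+ s = ((-1) ^+ s)%:MP :> S by rewrite rmorph_sign.
  apply: homogC; apply: homog_prod_linear => i.
  rewrite log_hessianE; apply: rpred_sum => j _.
  by rewrite -rmorphM; do 2 apply: homogC; apply: homogX.
Qed.

End RamHomogeneous.

Lemma mpoly_mpoly_morphism (K L : comNzRingType) (p q : nat) (f : {rmorphism K -> L})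
    (g : 'I_p -> L) (h : 'I_q -> L) :
  exists phi : {rmorphism {mpoly {mpoly K[p]}[q]} -> L},
    [/\ forall a, phi a%:MP%:MP = f a, forall i, phi ('X_i)%:MP = g i &
        forall i, phi 'X_i = h i].
Proof.
pose phi0 : {rmorphism {mpoly K[p]} -> L} := mmap f g.
exists (mmap phi0 h); split=> [a|i|i] /=; first by rewrite mmapC /= mmapC.
  by rewrite mmapC /= mmapX mmap1U.
by rewrite mmapX mmap1U.
Qed.

Lemma poly_mpoly_morphism (K L : comNzRingType) (p : nat) (f : {rmorphism K -> L})
    (g : 'I_p -> L) (y : L) :
  exists phi : {rmorphism {poly {mpoly K[p]}} -> L},
    [/\ forall a, phi a%:MP%:P = f a, forall i, phi ('X_i)%:P = g i & phi 'X = y].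
Proof.
pose phi0 : {rmorphism {mpoly K[p]} -> L} := mmap f g.
exists (horner_eval y \o map_poly phi0); rewrite /= /horner_eval.
split=> [a|i|]; first by rewrite map_polyC hornerC /= mmapC.
  by rewrite map_polyC hornerC /= mmapX mmap1U.
by rewrite map_polyX hornerX.
Qed.

Section RamPrime.
Variables (F : closedFieldType) (n d : nat).
Variables (A : 'M[F]_(n.+1, d)) (b : 'cV[F]_n.+1) (s : 'I_d.+2 -> 'I_n.+1).
Local Notation As := (rowsub s A).
Local Notation bs := (rowsub s b).
Variables (c e : 'cV[F]_d.+2) (Y : 'M[F]_(n.+1, d)).
Hypothesis row_neq0 : forall i, row i A != 0.
Hypothesis d_gt0 : (0 < d)%N.
Hypotheses (uL : uniform (row_mx bs As)^T) (uA : uniform As^T).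
Hypothesis det_c : forall (T : comNzRingType) (f : {rmorphism F -> T}) (v : 'cV[T]_d.+2),
  \det (row_mx v (map_mx f (row_mx bs As)) : 'M_d.+2) = \sum_i f (c i 0) * v i 0.
Hypothesis c_neq0 : forall i, c i 0 != 0.
Hypotheses (Ac : As^T *m c = 0) (bc : bs^T *m c = 0).
Hypotheses (Ae : As^T *m e = 0) (be : bs^T *m e = 1%:M).
Hypothesis AY : A^T *m Y = 1%:M.

Local Notation Q := {mpoly F[d.+1]}.
Local Notation S := {mpoly Q[n.+1]}.
Local Notation R := {mpoly F[d + n.+1]}.
Local Notation T := {poly R}.
Local Notation E := {fraction T}.
Local Notation inj := (polyC \o @mpolyC (d + n.+1) F).
Local Notation l := (coord_form A b).
Local Notation lam := (coord_prod A b).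
Local Notation hat := (coord_cofactor_prod A b).
Local Notation P := (kernel_proj A Y).
Local Notation ell := (ell A b).
Local Notation inv_ell := (inv_ell A b).
Local Notation tvar := (tvar F d).
Local Notation I := (Ram A b).

Let w : 'I_n.+1 -> T := weight A s c Y (fun i => 'X_(rshift d i)).
Let H : T := hessian_form A b s c Y (fun i => 'X_(rshift d i)).
Let idI : ideal I := ideal_gen_ideal _.

Let emb (a : T) : E := tofrac a.
Let lam0 : emb lam%:P != 0.
Proof. by rewrite tofrac_eq0 polyC_eq0 coord_prod_neq0. Qed.

(* The two morphisms enter only through their values on generators, keeping
   their explicit construction out of the computations below. *)
Variable param : {rmorphism S -> E}.
Hypothesis paramC : forall a, param a%:MP%:MP = emb a%:MP%:P.
Hypothesis param_x : forall j, param (xvar F j)%:MP = emb ('X_(lshift n.+1 j))%:P.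
Hypothesis param_t : param tvar%:MP = (emb lam%:P)^-1.
Hypothesis param_u : forall i, param 'X_i = emb ((l i)%:P * w i).

Variable retract : {rmorphism T -> S}.
Hypothesis retractC : forall a, retract a%:MP%:P = a%:MP%:MP.
Hypothesis retract_x : forall j, retract ('X_(lshift n.+1 j))%:P = (xvar F j)%:MP.
Hypothesis retract_v : forall k, retract ('X_(rshift d k))%:P = (inv_ell k)%:MP * 'X_k.
Hypothesis retract_y : retract 'X = 0.

Lemma embM p q : emb (p * q) = emb p * emb q.
Proof. exact: rmorphM. Qed.

Lemma embD p q : emb (p + q) = emb p + emb q.
Proof. exact: rmorphD. Qed.

Lemma emb_inj : injective emb.
Proof. by move=> p q /eqP; rewrite tofrac_eq => /eqP. Qed.

Lemma emb0 : emb 0 = 0.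
Proof. exact: rmorph0. Qed.

Lemma emb_sum (p : 'I_n.+1 -> T) : emb (\sum_i p i) = \sum_i emb (p i).
Proof. exact: rmorph_sum. Qed.

Lemma embX p k : emb (p ^+ k) = emb p ^+ k.
Proof. exact: rmorphXn. Qed.

Lemma paramM f g : param (f * g) = param f * param g.
Proof. exact: rmorphM. Qed.

Lemma param_ell i : param (ell i)%:MP = emb (l i)%:P.
Proof.
rewrite /Defs.ell /coord_form /emb !(rmorphD, rmorph_sum) paramC; apply: (f_equal2 +%R) => //.
by apply: eq_bigr => j _; rewrite !rmorphM paramC param_x.
Qed.

Lemma param_lam : param (\prod_j ell j)%:MP = emb lam%:P.
Proof.
rewrite !rmorph_prod /emb /coord_prod !rmorph_prod; apply: eq_bigr => j _.
exact: param_ell.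
Qed.

Lemma X_eqnE : (X_eqn A b)%:MP = tvar%:MP * (\prod_j ell j)%:MP - 1 :> S.
Proof. by rewrite /X_eqn mpolyCB mpolyCM. Qed.

Lemma param_inv_ell i : param (inv_ell i)%:MP * emb (l i)%:P = 1.
Proof.
rewrite -param_ell -paramM -mpolyCM /Defs.inv_ell -mulrA.
rewrite [X in tvar * X](_ : _ = \prod_j ell j); last by rewrite [RHS](bigD1 i) //= mulrC.
by rewrite mpolyCM paramM param_t param_lam mulVf.
Qed.

Lemma param_dual i : param ((inv_ell i)%:MP * 'X_i) = emb (w i).
Proof. by rewrite paramM param_u embM mulrA param_inv_ell mul1r. Qed.

Lemma retractM p q : retract (p * q) = retract p * retract q.
Proof. exact: rmorphM. Qed.

Lemma retract_coord i : retract (l i)%:P = (ell i)%:MP.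
Proof.
rewrite /Defs.ell /coord_form !(rmorphD, rmorph_sum) retractC; apply: (f_equal2 +%R) => //.
by apply: eq_bigr => j _; rewrite !rmorphM retractC retract_x.
Qed.

Lemma retract_hat i : retract (hat i)%:P = (\prod_(j | j != i) ell j)%:MP.
Proof. by rewrite !rmorph_prod; apply: eq_bigr => j _; rewrite retract_coord. Qed.

Lemma retract_lam : retract lam%:P = (\prod_j ell j)%:MP.
Proof. by rewrite !rmorph_prod; apply: eq_bigr => j _; rewrite retract_coord. Qed.

Lemma Ram_tvar : I (tvar%:MP * retract lam%:P - 1).
Proof.
rewrite retract_lam -X_eqnE.
by apply: mem_ideal_gen; apply: Or31.
Qed.

Lemma Ram_gradient k : I (log_gradient A b k 0).
Proof. by apply: mem_ideal_gen; apply: Or32; exists k. Qed.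

Lemma Ram_inv_ell i : I ((ell i)%:MP * (inv_ell i)%:MP - 1).
Proof.
suff -> : (ell i)%:MP * (inv_ell i)%:MP = tvar%:MP * retract lam%:P by exact: Ram_tvar.
rewrite retract_lam -!rmorphM /Defs.inv_ell mulrCA; congr (_ * _)%:MP.
by rewrite [RHS](bigD1 i).
Qed.

(** Modulo the gradient equations A^T w = 0 the projector P fixes w, so the
    retraction of a coordinate of y c + P v is that coordinate of w. *)
Lemma retract_weight i : I (retract (w i) - (inv_ell i)%:MP * 'X_i).
Proof.
have -> : retract (w i) = \sum_k (P i k)%:MP%:MP * ((inv_ell k)%:MP * 'X_k).
  rewrite /w /weight -mul_polyC rmorphD rmorphM retract_y mulr0 add0r !rmorph_sum.
  by apply: eq_bigr => k _; rewrite -retractC -retract_v -rmorphM /= -polyCM.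
pose u k : S := (inv_ell k)%:MP * 'X_k.
have -> : \sum_k (P i k)%:MP%:MP * u k - u i =
    - \sum_r (Y i r)%:MP%:MP * log_gradient A b r 0.
  have -> : \sum_k (P i k)%:MP%:MP * u k =
      \sum_k ((i == k)%:R * u k - \sum_r (Y i r * A k r)%:MP%:MP * u k).
    apply: eq_bigr => k _; rewrite !mxE !rmorphB mulrBl !rmorph_nat !rmorph_sum mulr_suml.
    by congr (_ - _); apply: eq_bigr => r _; rewrite mxE.
  rewrite sumrB (bigD1 i) //= eqxx mul1r big1 ?addr0 => [|k /negPf ki]; last first.
    by rewrite eq_sym ki mul0r.
  rewrite addrAC subrr sub0r exchange_big; congr (- _); apply: eq_bigr => r _.
  rewrite log_gradientE mulr_sumr; apply: eq_bigr => k _.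
  by rewrite [RHS]mulrA -2!mpolyCM.
rewrite -[- _]mulN1r; apply: (idealMl idI); apply: (ideal_sum idI) => r _.
by apply: (idealMl idI); apply: Ram_gradient.
Qed.

(** Modulo Ram the matrix retracts to lam times the Hessian matrix of the
    definition of Ram. *)
Lemma retract_hessian : I (retract H).
Proof.
pose M : 'M[S]_d := \matrix_(j, k) (retract lam%:P * log_hessian A b j k).
have detM : \det M = retract lam%:P ^+ d * \det (log_hessian A b).
  rewrite -detZ; congr (\det _); apply/matrixP => j k; by rewrite !mxE.
apply: (ideal_congr idI (b := \det M)); last first.
  by rewrite detM; apply: (idealMl idI); apply: mem_ideal_gen; apply: Or33.
rewrite /H /hessian_form -det_map_mx; apply: (ideal_congr_det idI) => j k.
rewrite mxE [X in retract X]mxE [M _ _]mxE log_hessianE mulr_sumr rmorph_sum.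
apply: (ideal_congr_sumr idI) => i.
rewrite [X in I (X - _)](_ : _ = (A i j * A i k)%:MP%:MP *
    (retract (w i) * (\prod_(j | j != i) ell j)%:MP)); last first.
  rewrite -(retractC (A i j * A i k)) -(retract_hat i).
  by rewrite -(retractM (w i)) -retractM.
pose a : S := (A i j)%:MP%:MP; pose a' : S := (A i k)%:MP%:MP; rewrite -/a -/a'.
have -> : (A i j * A i k)%:MP%:MP = a * a' :> S by rewrite -2!mpolyCM.
have -> : retract lam%:P * (a * a' * ((inv_ell i ^+ 2)%:MP * 'X_i)) =
   (a * a') * (((inv_ell i)%:MP * 'X_i) * (retract lam%:P * (inv_ell i)%:MP)).
  by rewrite rmorphXn; ring.
apply: (ideal_congrM idI); first exact: ideal_congr_refl.
apply: (ideal_congrM idI); first exact: retract_weight.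
have -> : retract lam%:P * (inv_ell i)%:MP =
    (\prod_(j | j != i) ell j)%:MP * ((ell i)%:MP * (inv_ell i)%:MP).
  rewrite retract_lam mulrA -mpolyCM; have -> // : \prod_j ell j = \prod_(j | j != i) ell j * ell i.
  by rewrite (bigD1 i) //= mulrC.
rewrite -[X in X - _]mulr1; apply: (ideal_congrM idI); first exact: ideal_congr_refl.
apply: (ideal_congr_sym idI); exact: Ram_inv_ell.
Qed.

Lemma param_clears f : clears (@tofrac T) param retract I lam%:P f.
Proof.
elim/mpoly_ring_ind: f => [q|i|f g|f g].
- elim/mpoly_ring_ind: q => [a|i|p q|p q].
  + apply: clears_cst; first exact: paramC.
    by rewrite retractC; apply: ideal_congr_refl.
  + case: (unliftP ord_max i) => [j ->|->].
      apply: clears_cst; first exact: param_x.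
      by rewrite retract_x; apply: ideal_congr_refl.
    exists 1, 1; split; first by rewrite expr1 param_t mulfV // rmorph1.
    by rewrite expr1 rmorph1 mulrC; apply: Ram_tvar.
  + by rewrite rmorphD; apply: clearsD.
  + by rewrite rmorphM; apply: clearsM.
- apply: clears_cst; first exact: param_u.
  apply: (ideal_congr_sym idI); rewrite rmorphM retract_coord -['X_i in X in _ - X]mul1r.
  apply: (ideal_congr_trans idI (b := (ell i)%:MP * ((inv_ell i)%:MP * 'X_i))).
    apply: (ideal_congrM idI); first exact: ideal_congr_refl.
    exact: retract_weight.
  rewrite mulrA; apply: (ideal_congrM idI); last exact: ideal_congr_refl.
  exact: Ram_inv_ell.
- exact: clearsD.
- exact: clearsM.
Qed.

Lemma param_reduce f : exists N a,
  emb lam%:P ^+ N * param f = emb a /\ I (retract lam%:P ^+ N * f - retract a).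
Proof.
by have [N [a [Ea Ia]]] := param_clears f; exists N, a; rewrite -embX.
Qed.

Lemma sum_weight (g : 'I_n.+1 -> F) : \sum_i g i * extend s c i 0 = 0 ->
  \sum_i inj (g i) * w i = (\sum_k (\sum_i g i * P i k)%:MP * 'X_(rshift d k))%:P.
Proof.
move=> gc; transitivity (inj (\sum_i g i * extend s c i 0) * 'X
    + \sum_i \sum_k (inj (g i * P i k) * ('X_(rshift d k))%:P)).
  rewrite rmorph_sum mulr_suml -big_split; apply: eq_bigr => i _.
  rewrite /w /weight -mul_polyC mulrDr; apply: (f_equal2 +%R).
    by rewrite mulrA (rmorphM inj).
  rewrite rmorph_sum mulr_sumr; apply: eq_bigr => k _.
  by rewrite rmorphM mulrA (rmorphM inj).
rewrite gc rmorph0 mul0r add0r exchange_big rmorph_sum; apply: eq_bigr => k _.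
by rewrite rmorphM -mulr_suml !rmorph_sum.
Qed.

(** From left to right, the condition defines an ideal that contains the
    generators of Ram. From right to left, the equation is carried back by
    the retraction, which sends H into Ram; the powers of lam are then removed
    because lam is invertible modulo Ram. *)
Lemma Ram_param f : I f <->
  exists M g, emb lam%:P ^+ M * param f = emb (H * g).
Proof.
pose J f := exists M g, emb lam%:P ^+ M * param f = emb (H * g).
have idJ : ideal J.
  split=> [|a a' [M [g Eg]] [M' [g' Eg']]|a f' [M [g Eg]]].
  - by exists 0%N, 0; rewrite mulr0 !rmorph0 mulr0.
  - exists (M + M')%N, (lam%:P ^+ M' * g + lam%:P ^+ M * g').
    rewrite mulrDr embD 2!(mulrCA H) (embM (lam%:P ^+ M')) (embM (lam%:P ^+ M)) !embX.
    by rewrite -Eg -Eg' exprD rmorphD mulrDr mulrCA -!mulrA [X in _ + X]mulrCA mulrCA.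
  - have [N [a' [Ea _]]] := param_reduce a.
    by exists (N + M)%N, (a' * g); rewrite exprD paramM mulrACA Eg Ea mulrCA (embM a').
split=> [If|[M [g Eg]]].
  apply: (If J idJ) => h [->|[k ->]|->].
  - exists 0%N, 0; rewrite mulr0 emb0 X_eqnE rmorphB paramM param_t param_lam.
    by rewrite mulVf // rmorph1 subrr mulr0.
  - exists 0%N, 0; rewrite mulr0 emb0 log_gradientE rmorph_sum.
    suff -> : \sum_i param ((A i k)%:MP%:MP * ((inv_ell i)%:MP * 'X_i)) =
        emb (\sum_i inj (A i k) * w i).
      rewrite sum_weight; last first.
        have := extend_mul s A c; rewrite Ac => /matrixP/(_ k 0); rewrite mxE [RHS]mxE => E0.
        by rewrite -[RHS]E0; apply: eq_bigr => i _; rewrite [X in _ = X * _]mxE.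
      rewrite big1 ?rmorph0 ?mulr0 // => r _.
      have : A^T *m P = 0 by rewrite mulmxBr mulmx1 mulmxA AY mul1mx subrr.
      move/matrixP/(_ k r); rewrite mxE [RHS]mxE => E0.
      have -> : \sum_i A i k * P i r = 0.
        by rewrite -[RHS]E0; apply: eq_bigr => i _; rewrite [in RHS]mxE.
      by rewrite rmorph0 mul0r.
    rewrite emb_sum; apply: eq_bigr => i _.
    by rewrite paramM paramC param_dual embM.
  - exists d, 1; rewrite mulr1 -det_map_mx -detZ /H /hessian_form /emb -det_map_mx.
    congr (\det _); apply/matrixP => j k.
    rewrite 2![in LHS]mxE log_hessianE [RHS]mxE [in RHS]mxE.
    apply: etrans (esym (emb_sum _)); rewrite rmorph_sum mulr_sumr.
    apply: eq_bigr => i _.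
    have -> : inj (A i j * A i k) = (A i j)%:MP%:P * (A i k)%:MP%:P by exact: injM.
    have -> : lam%:P = (hat i)%:P * (l i)%:P by rewrite -polyCM hat_coord.
    have -> : (inv_ell i ^+ 2)%:MP = (inv_ell i)%:MP ^+ 2 :> S by rewrite rmorphXn.
    rewrite -[weight _ _ _ _ _ _]/(w i).
    have emb4 x y z t : emb (x * y * (z * t)) = emb x * emb y * (emb z * emb t).
      by rewrite !embM.
    have param4 x y z t : param (x * y * (z ^+ 2 * t)) =
        param x * param y * (param z ^+ 2 * param t) by rewrite !paramM.
    rewrite param4 [RHS]emb4 !paramC param_u. 
    rewrite -[tofrac _]/(emb ((hat i)%:P * (l i)%:P)) (embM (hat i)%:P) (embM (l i)%:P).
    have := param_inv_ell i.
    move: (param (inv_ell i)%:MP) (emb (l i)%:P) (emb (hat i)%:P) (emb (w i)).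
    move: (emb (A i j)%:MP%:P) (emb (A i k)%:MP%:P) => x1 x2 x3 x4 x5 x6 x34.
    transitivity (x1 * x2 * (x6 * x5) * (x3 * x4) ^+ 2); first by ring.
    by rewrite x34 expr1n mulr1.
have [N [a [Ea Ia]]] := param_reduce f.
have Ha : lam%:P ^+ M * a = lam%:P ^+ N * (H * g).
  apply: emb_inj; rewrite (embM (lam%:P ^+ M)) (embM (lam%:P ^+ N)) !embX -Ea -Eg.
  exact: mulrCA.
have ra : I (retract lam%:P ^+ (M + N) * f).
  apply: (ideal_congr idI (b := retract lam%:P ^+ M * retract a)).
    by rewrite exprD -mulrA -mulrBr; apply: (idealMl idI).
  rewrite -rmorphXn -rmorphM Ha !rmorphM; apply: (idealMl idI).
  by apply: (idealMr idI); apply: retract_hessian.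
by apply: (ideal_unit_cancel idI _ ra (b := tvar%:MP)); rewrite mulrC; apply: Ram_tvar.
Qed.

Lemma size_hessian : size H = d.+1.
Proof.
by have [] := lead_coef_hessian_form Y row_neq0 det_c c_neq0 Ac bc Ae be
  (fun i => 'X_(rshift d i)).
Qed.

Lemma hessian_not_divides_const r g : r != 0 -> r%:P <> H * g :> T.
Proof.
move=> r0 Eg; have g0 : g != 0.
  by apply: contraNneq r0 => g0; rewrite -polyC_eq0 Eg g0 mulr0.
have H0 : H != 0 by rewrite -size_poly_eq0 size_hessian.
have := congr1 (fun p : T => size p) Eg.
rewrite size_polyC r0 size_mul // size_hessian addSn /= => /eqP.
by rewrite -[size g]prednK ?size_poly_gt0 // addnS eqSS eq_sym addn_eq0 (gtn_eqF d_gt0).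
Qed.

Lemma Ram_prime : prime_ideal I.
Proof.
split=> //.
  move/Ram_param => [M [g]]; rewrite rmorph1 mulr1 -embX => /emb_inj.
  by rewrite -polyC_exp; apply: hessian_not_divides_const; rewrite expf_neq0 // coord_prod_neq0.
move=> f f' /Ram_param [M [g Eg]].
have [N [a [Ea _]]] := param_reduce f; have [N' [a' [Ea' _]]] := param_reduce f'.
have : divides H (lam%:P ^+ M * a * a').
  (* lam^M f f' = H g, multiplied by lam^N lam^N'. *)
  exists (lam%:P ^+ (N + N') * g); apply: emb_inj; rewrite [in RHS]mulrCA.
  rewrite (embM (lam%:P ^+ M * a)) (embM (lam%:P ^+ M)) (embM (lam%:P ^+ (N + N'))).
  rewrite !embX -Eg -Ea -Ea' paramM exprD.
  by move: (emb lam%:P) (param f) (param f') => x y z; ring.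
case/(hessian_form_quasi_prime row_neq0 d_gt0 uL uA det_c c_neq0 Ac bc Ae be) => K.
case=> [[q Eq]|[q Eq]]; [left|right]; apply/Ram_param.
  exists (K + M + N)%N, q; rewrite -[H * q]Eq mulrA (embM (_ ^+ K * _)) (embM (_ ^+ K)).
  by rewrite !embX -Ea !exprD !mulrA.
by exists (K + N')%N, q; rewrite -[H * q]Eq (embM (_ ^+ K)) embX -Ea' exprD mulrA.
Qed.

(** If Ram contained every u_i it would contain sum_i b_i w_i, whose pullback
    b^T P v is a nonzero constant in y since b^T c = 0 and b^T P e = 1; but H
    has positive degree in y. *)
Lemma Ram_proper : exists i : 'I_n.+1, ~ I 'X_i.
Proof.
apply: boolp.contrapT => noX.
have IX i : I 'X_i by apply: boolp.contrapT => nIX; apply: noX; exists i.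
pose z := \sum_i (b i 0)%:MP%:MP * ((inv_ell i)%:MP * 'X_i) : S.
have Iz : I z.
  apply: (ideal_sum idI) => i _; apply: (idealMl idI); apply: (idealMl idI); exact: IX.
have /Ram_param [M [g]] := Iz.
have -> : param z = emb (\sum_i inj (b i 0) * w i).
  rewrite rmorph_sum emb_sum; apply: eq_bigr => i _.
  by rewrite paramM paramC param_dual embM.
rewrite sum_weight; last first.
  have := extend_mul s b c; rewrite bc => /matrixP/(_ 0 0); rewrite mxE [RHS]mxE => E0.
  by rewrite -[RHS]E0; apply: eq_bigr => i _; rewrite [X in _ = X * _]mxE.
set r := \sum_k _; rewrite -embX -embM => /emb_inj; rewrite -polyC_exp -polyCM.
apply: hessian_not_divides_const; rewrite mulf_neq0 ?expf_neq0 ?coord_prod_neq0 //.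
pose ev := meval (fun i : 'I_(d + n.+1) => if split i is inr k then extend s e k 0 else 0).
suff : ev r = 1 by apply: contra_eqN => /eqP ->; rewrite /ev meval0 eq_sym oner_eq0.
have := extend_mul s b e; rewrite be -(proj_extend Y Ae) mulmxA => /matrixP/(_ 0 0).
rewrite mxE [RHS]mxE eqxx => E1; apply: etrans E1.
rewrite /ev /r raddf_sum; apply: eq_bigr => k _ /=.
rewrite mevalM mevalC mevalXU (unsplitK (inr k)); apply: (f_equal2 *%R) => //.
by rewrite [RHS]mxE; apply: eq_bigr => i _; rewrite [in RHS]mxE.
Qed.

Lemma Ram_proj_point : proj_point I.
Proof. by split; [exact: Ram_prime | exact: Ram_homog | exact: Ram_proper]. Qed.

End RamPrime.

(** * The theorem *)

(** The morphisms of the previous part exist, as do the vectors c and e; the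
    matrix Y with A^T Y = 1, from which P = 1 - Y A^T is built, comes from an
    invertible d x d minor of A. *)
Lemma proj_point_Ram (F : closedFieldType) (n d : nat) (A : 'M[F]_(n.+1, d))
    (b : 'cV[F]_n.+1) (s : 'I_d.+2 -> 'I_n.+1) :
  (0 < d)%N -> (forall i, row i A != 0) ->
  uniform (colsub s (row_mx b A)^T) -> uniform (colsub s A^T) ->
  proj_point (Ram A b).
Proof.
move=> d_gt0 row_neq0.
have -> : colsub s (row_mx b A)^T = (row_mx (rowsub s b) (rowsub s A))^T.
  by apply/matrixP => i j; rewrite !mxE; case: split => k; rewrite mxE.
have -> : colsub s A^T = (rowsub s A)^T by apply/matrixP => i j; rewrite !mxE.
move=> uL uA.
have [c [det_c c_neq0 Ac bc]] := circuit_exists uL.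
have [e [Ae be]] := pencil_exists uL.
have [Y AY] : exists Y, A^T *m Y = 1%:M.
  have le_d : (d <= d.+2)%N by rewrite -addn2 leq_addr.
  have inj_w : injective (widen_ord le_d) by move=> i j /(congr1 val) /= /val_inj.
  have := uniform_colsub le_d uA inj_w.
  set M := colsub _ _ => detM.
  have unitM : M \in unitmx by rewrite unitmxE unitfE.
  exists (colsub (s \o widen_ord le_d) 1%:M *m invmx M).
  rewrite mulmxA mulmx_colsub mulmx1 -[RHS](mulmxV unitM); congr (_ *m _).
  by apply/matrixP => i j; rewrite !mxE.
pose l := coord_form A b; pose lam := coord_prod A b.
pose w := weight A s c Y (fun i => 'X_(rshift d i)).
pose emb := @tofrac {poly {mpoly F[d + n.+1]}}.
have [param [pC pX pu]] := mpoly_mpoly_morphism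
  (emb \o polyC \o @mpolyC (d + n.+1) F)
  (fun i => if unlift ord_max i is Some j
            then emb ('X_(lshift n.+1 j))%:P else (emb lam%:P)^-1)
  (fun i => emb ((l i)%:P * w i)).
have [retract [rC rX ry]] := poly_mpoly_morphism
  ((@mpolyC n.+1 {mpoly F[d.+1]}) \o (@mpolyC d.+1 F))
  (fun i => match split i with
            | inl j => (xvar F j)%:MP | inr k => (inv_ell A b k)%:MP * 'X_k end) 0.
apply: (Ram_proj_point row_neq0 d_gt0 uL uA det_c c_neq0 Ac bc Ae be AY
  (param := param) pC _ _ pu (retract := retract) rC _ _ ry).
- by move=> j; rewrite /xvar pX liftK.
- by rewrite /tvar pX unlift_none.
- by move=> j; rewrite rX (unsplitK (inl j)).
- by move=> k; rewrite rX (unsplitK (inr k)).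
Qed.

Theorem theorem6p1 (R : realType) (n d : nat)
    (A : 'M[R[i]]_(n.+1, d)) (b : 'cV[R[i]]_n.+1) :
  (1 <= d)%N ->
  (d.+2 <= n.+1)%N ->
  (forall i, row i A != 0) ->
  (exists s : 'I_d.+2 -> 'I_n.+1,
     [/\ injective s,
         uniform (colsub s (row_mx b A)^T) &
         uniform (colsub s A^T)]) ->
  (reduced_scheme (Ram A b) /\ irreducible_scheme (Ram A b)) /\
  (reduced_scheme (log_discriminant A b) /\
   irreducible_scheme (log_discriminant A b)).
Proof.
move=> d_gt0 _ row_neq0 [s [_ uL uA]].
have ptRam := proj_point_Ram d_gt0 row_neq0 uL uA.
have ptDisc := proj_point_scheme_image (@mpolyC d.+1 R[i]) ptRam.
by split; split; first [exact: reduced_proj_point | exact: irreducible_proj_point].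
Qed.
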